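(* In the setting described in the context, the return map $loc\circ glob:S_1\to S_1$, written in the coordinates $(z,r,\phi)$ with $z:=\ln\!\big(\tfrac{v_2}{h}\big)$ (so $z\to-\infty$ as $v_2\to0$), is given by $$\begin{pmatrix}z\\ r\\ \phi\end{pmatrix}\mapsto\begin{pmatrix}\big(\ln(a_1(r,\phi))+z\big)\cdot\dfrac{-\varsigma(b_0(r,\phi))}{p(b_0(r,\phi))}+O(z\,e^z)\\[2mm] b_0(r,\phi)+O(e^z)\\[1mm] \Big(c_0(r,\phi)-\dfrac{\omega(b_0(r,\phi))}{p(b_0(r,\phi))}\ln(a_1(r,\phi))\Big)+\dfrac{-\omega(b_0(r,\phi))}{p(b_0(r,\phi))}\,z+O(z\,e^z)\pmod 1\end{pmatrix}.$$
   Context: Setting. A real analytic system $\dot x=F(x)$ in $\mathbb R^4$ has a saddle-center at $0$ with a two-dimensional compact center manifold $D=W^c(0)$ foliated by periodic orbits, and the three-dimensional stable and unstable manifolds of $D$ coincide, forming a non-transverse homoclinic channel $I$. Near $D$ there are analytic coordinates $(v_1,v_2,r,\phi)$, with $(r,\phi)$ polar coordinates on $D=\{v_1=v_2=0\}$, $r\in[0,1]$, $\phi$ taken mod $1$, in which the system reads $$\dot v_1=p(r)v_1+p_0v_1^2v_2,\quad \dot v_2=\varsigma(r)v_2+\varsigma_0v_1v_2^2,\quad \dot r=v_1v_2r_0,\quad \dot\phi=\omega(r)+v_1v_2\omega_0,$$ where $p_0,\varsigma_0,r_0,\omega_0$ are analytic functions of $(v_1,v_2,r,\phi)$, $1$-periodic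 in $\phi$. Standing assumption: $p(r)>0$, $\varsigma(r)<0$, $p(r)+\varsigma(r)<0$ for all $r$. For small $h>0$ let $S_1=\{v_1=h\}$ (coordinates $(v_2,r,\phi)$) and $S_2=\{v_2=h\}$ (coordinates $(v_1,r,\phi)$). $loc:S_2\to S_1$ is the local map given by the flow near $D$. $glob:S_1\to S_2$ is the global map along $I$; it is assumed analytic, and its expansion in small $v_2$ is $$glob(v_2,r,\phi)=\big(a_1(r,\phi)v_2,\ b_0(r,\phi)+b_1(r,\phi)v_2,\ c_0(r,\phi)+c_1(r,\phi)v_2\big)+\text{higher order terms in }v_2,$$ which defines $a_1,b_0,b_1,c_0,c_1$. Points with $v_2>0$ small are considered. *)

(* Defs.v *)
From HB Require Import structures.
From mathcomp Require Import all_boot all_order all_algebra.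
From mathcomp Require Import all_classical all_reals all_analysis.

Set Implicit Arguments.
Unset Strict Implicit.
Unset Printing Implicit Defensive.

Import Order.TTheory GRing.Theory Num.Theory.
Import numFieldNormedType.Exports.

Local Open Scope classical_set_scope.
Local Open Scope ring_scope.

(* For a literal list such as [:: a; b; c] the type is convertible to
   'rV[R]_3. *)
Definition vec (R : realType) (s : seq R) : 'rV[R]_(size s) :=
  \row_(i < size s) s`_i.

(* Partial sum of a power series in n variables over the multi-indices
   k with all k i < N. *)
Definition box_sum (R : realType) (n : nat) (c : {ffun 'I_n -> nat} -> R)
    (x : 'rV[R]_n) (N : nat) : R :=
  \sum_(k : {ffun 'I_n -> 'I_N})
     c [ffun i => k i : nat] * \prod_(i < n) x 0 i ^+ k i.

(* Real analyticity at the point a: on a polydisc around a, f is the sum of an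
   absolutely convergent power series. For absolutely convergent series,
   summation over growing boxes agrees with any other order of summation. *)
Definition analytic_at (R : realType) (n : nat) (f : 'rV[R]_n -> R)
    (a : 'rV[R]_n) : Prop :=
  exists (c : {ffun 'I_n -> nat} -> R) (rho : R), 0 < rho /\
    forall x : 'rV[R]_n, (forall i, `|x 0 i| < rho) ->
      cvgn (box_sum (fun k => `|c k|) (map_mx Num.norm x)) /\
      (box_sum c x @ \oo --> f (a + x)).

Definition analytic1_at (R : realType) (f : R -> R) (a : R) : Prop :=
  analytic_at (fun x : 'rV[R]_1 => f (x 0 0)) (vec [:: a]).

(* The system near the center manifold D = {v1 = v2 = 0, 0 <= r <= 1}.
   Analyticity up to the boundary of the closed range r \in [0, 1] means
   analyticity on a neighborhood; being compact modulo phi |-> phi + 1, D has a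
   neighborhood basis of boxes as below, with delta the size of the coordinate
   domain. The angle phi is lifted from R/Z to R.
   The functions p0, sigma0, r0, omega0 take (v1, v2, r, phi). *)
Record local_system (R : realType) := LocalSystem {
  delta : R;
  p : R -> R;
  sigma : R -> R;
  omega : R -> R;
  p0 : 'rV[R]_4 -> R;
  sigma0 : 'rV[R]_4 -> R;
  r0 : 'rV[R]_4 -> R;
  omega0 : 'rV[R]_4 -> R;
  in_chart := fun v1 v2 r : R =>
    [/\ `|v1| < delta, `|v2| < delta & - delta < r < 1 + delta];
  delta_gt0 : 0 < delta;
  rate_analytic : forall r, - delta < r < 1 + delta ->
    [/\ analytic1_at p r, analytic1_at sigma r & analytic1_at omega r];
  rate_sign : forall r, 0 <= r <= 1 ->
    [/\ 0 < p r, sigma r < 0 & p r + sigma r < 0];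
  coef_analytic : forall v1 v2 r phi, in_chart v1 v2 r ->
    let x := vec [:: v1; v2; r; phi] in
    [/\ analytic_at p0 x, analytic_at sigma0 x,
        analytic_at r0 x & analytic_at omega0 x];
  coef_periodic : forall v1 v2 r phi, in_chart v1 v2 r ->
    let x := vec [:: v1; v2; r; phi] in
    let x' := vec [:: v1; v2; r; phi + 1] in
    [/\ p0 x' = p0 x, sigma0 x' = sigma0 x, r0 x' = r0 x & omega0 x' = omega0 x]
}.

Definition is_orbit (R : realType) (X : local_system R) (T : R)
    (v1 v2 r phi : R -> R) : Prop :=
  [/\ {within `[0, T], continuous v1}, {within `[0, T], continuous v2},
      {within `[0, T], continuous r} & {within `[0, T], continuous phi}] /\
  (forall t, 0 <= t <= T -> in_chart X (v1 t) (v2 t) (r t)) /\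
  forall t, 0 < t < T ->
    let x := vec [:: v1 t; v2 t; r t; phi t] in
    [/\ is_derive t 1 v1 (p X (r t) * v1 t + p0 X x * v1 t ^+ 2 * v2 t),
        is_derive t 1 v2 (sigma X (r t) * v2 t + sigma0 X x * v1 t * v2 t ^+ 2),
        is_derive t 1 r (v1 t * v2 t * r0 X x) &
        is_derive t 1 phi (omega X (r t) + v1 t * v2 t * omega0 X x)].

(* Graph of the local map from S2 = {v2 = h}, with coordinates (v1, r, phi), to
   S1 = {v1 = h}, with coordinates (v2, r, phi): the orbit of the first point
   inside the chart has its first hit with S1 at the second point. *)
Definition loc (R : realType) (X : local_system R) (h : R)
    (v1 r phi v2' r' phi' : R) : Prop :=
  exists (T : R) (x1 x2 rho theta : R -> R),
    [/\ 0 <= T, is_orbit X T x1 x2 rho theta,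
        [/\ x1 0 = v1, x2 0 = h, rho 0 = r & theta 0 = phi],
        [/\ x1 T = h, x2 T = v2', rho T = r' & theta T = phi'] &
        forall t, 0 <= t < T -> x1 t < h].

(* An analytic map from S1 to S2, given on the neighborhood
   |v2| < eps of {v2 = 0, 0 <= r <= 1} by its components
   (v2, r, phi) |-> (glob_v1, glob_r, glob_phi). The circle-valued last
   component is represented by a lift to R; glob_deg is its degree. *)
Record global_map (R : realType) := GlobalMap {
  glob_eps : R;
  glob_v1 : 'rV[R]_3 -> R;
  glob_r : 'rV[R]_3 -> R;
  glob_phi : 'rV[R]_3 -> R;
  glob_deg : int;
  glob_eps_gt0 : 0 < glob_eps;
  glob_analytic : forall v2 r phi,
    `|v2| < glob_eps -> - glob_eps < r < 1 + glob_eps ->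
    let x := vec [:: v2; r; phi] in
    [/\ analytic_at glob_v1 x, analytic_at glob_r x & analytic_at glob_phi x];
  glob_periodic : forall v2 r phi,
    `|v2| < glob_eps -> - glob_eps < r < 1 + glob_eps ->
    let x := vec [:: v2; r; phi] in
    let x' := vec [:: v2; r; phi + 1] in
    [/\ glob_v1 x' = glob_v1 x, glob_r x' = glob_r x &
        glob_phi x' = glob_phi x + glob_deg%:~R]
}.

(* The expansion of glob in small v2. As the neighborhoods of 0 below include
   0 itself, it yields glob_v1 = 0, glob_r = b0 and glob_phi = c0 at v2 = 0. *)
Definition glob_expansion (R : realType) (g : global_map R)
    (a1 b0 b1 c0 c1 : R -> R -> R) : Prop :=
  forall r phi : R, 0 <= r <= 1 ->
  [/\ (fun v2 : R => glob_v1 g (vec [:: v2; r; phi]) - a1 r phi * v2 : R^o)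
        =O_ (nbhs (0 : R)) (fun v2 : R => v2 ^+ 2 : R^o),
      (fun v2 : R =>
         glob_r g (vec [:: v2; r; phi]) - (b0 r phi + b1 r phi * v2) : R^o)
        =O_ (nbhs (0 : R)) (fun v2 : R => v2 ^+ 2 : R^o) &
      (fun v2 : R =>
         glob_phi g (vec [:: v2; r; phi]) - (c0 r phi + c1 r phi * v2) : R^o)
        =O_ (nbhs (0 : R)) (fun v2 : R => v2 ^+ 2 : R^o)].

Definition return_map (R : realType) (X : local_system R) (h : R)
    (g : global_map R) (v2 r phi v2' r' phi' : R) : Prop :=
  let x := vec [:: v2; r; phi] in
  loc X h (glob_v1 g x) (glob_r g x) (glob_phi g x) v2' r' phi'.

(* Main.v *)
Require Import Defs.
From mathcomp Require Import all_boot all_order all_algebra.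
From mathcomp Require Import all_classical all_reals all_analysis.
From mathcomp Require Import ring lra.

Set Implicit Arguments.
Unset Strict Implicit.
Unset Printing Implicit Defensive.

Import Order.TTheory GRing.Theory Num.Theory.
Import numFieldNormedType.Exports.

Local Open Scope classical_set_scope.
Local Open Scope ring_scope.

(** Near D the product u = v1 v2 satisfies u' = u (p + sigma + O(u)) with
    p + sigma < 0, so along an orbit that starts at (v1, v2) = (w, h) it decays
    exponentially from w h, and its time integral is O(w). Hence r, whose
    derivative is O(u), changes by O(w) only: the orbit stays near the circle
    r = b, where b = b0(r, phi), and ln v1, ln v2 and phi grow at the rates p(b),
    sigma(b), omega(b) up to an error O(w) (the lemmas box_estimates and
    orbit_asymptotics). With T the passage time to S1 this gives

      ln h - ln w = p(b) T + O(w T),       ln v2(T) - ln h = sigma(b) T + O(w T),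
      phi(T) - phi(0) = omega(b) T + O(w T).

    The point of S2 comes from the global map, so w = a1 v2 (1 + O(v2)) and
    ln (w / h) = ln a1 + z + O(e^z); in particular T = O(|z|) and w = O(e^z).
    Eliminating T between the first relation and each of the other two yields the
    formula, the errors O(w T) being O(z e^z). The angles are lifted to R along
    the orbit, so the congruence modulo 1 holds with the integer 0.

    Two things remain. The constants have to be uniform in (r, phi): analytic
    functions are Lipschitz near each point, glob has a second order remainder in
    v2 near each point, and compactness of the period cell together with
    periodicity in phi makes these bounds uniform (coef_lipschitz, slope_uniform).
    And the orbit has to exist up to S1: extending the vector field from the box
    |v1|, |v2| <= H, - d <= r <= 1 + d by clamping the coordinates makes it
    globally Lipschitz, Picard iteration gives a solution for all positive times
    (global_solution), and the same estimates show that it cannot leave the box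
    before reaching S1, which it does because v1 grows exponentially. *)

(** * Local bounds for analytic functions *)

(** A linear combination of evaluations of f is the sum of the same combinations
    of monomials, so a bound on monomials passes to f by absolute convergence.
    Boundedness, Lipschitz estimates and Taylor remainders are all of this form,
    with one, two or four evaluation points. *)
Lemma analytic_functional_bound (R : realType) (n : nat) (f : 'rV[R]_n -> R)
    (a : 'rV[R]_n) :
  analytic_at f a ->
  exists rho A : R, [/\ 0 < rho, 0 < A &
  forall (s : seq (R * 'rV[R]_n)) (E : R), 0 <= E ->
    (forall wx, wx \in s -> forall i, `|wx.2 0 i| <= rho) ->
    (forall k : {ffun 'I_n -> nat},
      `|\sum_(wx <- s) wx.1 * \prod_(i < n) wx.2 0 i ^+ k i|
        <= E * rho ^+ (\sum_(i < n) k i)%N) ->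
    `|\sum_(wx <- s) wx.1 * f (a + wx.2)| <= E * A].
Proof.
move=> [c [rho [rho0 cf]]].
have rho2 : 0 < rho / 2 by lra.
have [|/cvg_seq_bounded bnd _] := cf (const_mx (rho / 2)).
  by move=> i; rewrite mxE ger0_norm; lra.
have /pinfty_ex_gt0[A A0 /= bA] := bnd.
exists (rho / 2), A; split => // s E E0 sP kP.
(* A bounds all partial sums of the absolute series on the polydisc of radius rho / 2. *)
have cvS : (fun N => \sum_(wx <- s) wx.1 * box_sum c wx.2 N) @ \oo -->
    \sum_(wx <- s) wx.1 * f (a + wx.2).
  elim: s sP {kP} => [|wx s IH] sP.
    by under eq_fun do rewrite big_nil; rewrite big_nil; exact: cvg_cst.
  under eq_fun do rewrite big_cons; rewrite big_cons.
  apply: cvgD; last first.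
    by apply: IH => y ys; apply: sP; rewrite in_cons ys orbT.
  apply: cvgMr; apply: (cf _ _).2 => i.
  by apply: le_lt_trans (sP wx (mem_head _ _) i) _; lra.
apply: (cvgr_to_le (cvg_norm cvS)).
near=> N.
have := bA N I; rewrite ger0_norm; last first.
  by apply: sumr_ge0 => k _; rewrite mulr_ge0// prodr_ge0// => i _;
     rewrite exprn_ge0// !mxE.
move=> /(ler_wpM2l E0); apply: le_trans.
rewrite /box_sum mulr_sumr.
under eq_bigr do rewrite mulr_sumr.
rewrite exchange_big/=.
apply: le_trans (ler_norm_sum _ _ _) _; apply: ler_sum => k _.
under eq_bigr do rewrite mulrCA.
rewrite -mulr_sumr normrM [leRHS]mulrCA ler_wpM2l//.
have := kP [ffun i => k i : nat].
under eq_bigr do under eq_bigr do rewrite ffunE.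
move/le_trans; apply; rewrite ler_wpM2l//.
rewrite expr_sum le_eqVlt; apply/orP; left; apply/eqP; apply: eq_bigr => i _.
by rewrite ffunE !mxE ger0_norm// ltW.
Unshelve. all: by end_near.
Qed.

(** The factor k of the derivative of x^k is absorbed by doubling the radius, as
    k <= 2^k. *)
Lemma monomial_lipschitz (R : realType) (n : nat) (x y : 'rV[R]_n) (e D : R)
    (k : {ffun 'I_n -> nat}) : 0 < e -> 0 <= D ->
  (forall i, `|x 0 i| <= e) -> (forall i, `|y 0 i| <= e) ->
  (forall i, `|x 0 i - y 0 i| <= D * e) ->
  `|\prod_(i < n) x 0 i ^+ k i - \prod_(i < n) y 0 i ^+ k i|
    <= D * (2 * e) ^+ (\sum_(i < n) k i)%N.
Proof.
move=> e0 D0 xe ye xy.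
(* P is closed under products, which reduces the claim to single coordinates. *)
pose P (a b : R) (m : nat) :=
  [/\ `|a| <= e ^+ m, `|b| <= e ^+ m & `|a - b| <= D * m%:R * e ^+ m].
have P1 : P 1 1 0%N.
  by split; rewrite ?expr0 ?normr1// subrr normr0 mulr0 mul0r.
have PM a b m a' b' m' : P a b m -> P a' b' m' -> P (a * a') (b * b') (m + m')%N.
  move=> [a1 b1 ab1] [a2 b2 ab2]; split; rewrite ?normrM ?exprD ?ler_pM//.
  have -> : a * a' - b * b' = (a - b) * a' + b * (a' - b') by ring.
  apply: le_trans (ler_normD _ _) _; rewrite !normrM.
  apply: le_trans (lerD (ler_pM _ _ ab1 a2) (ler_pM _ _ b1 ab2)) _ => //.
  by rewrite natrD le_eqVlt; apply/orP; left; apply/eqP; ring.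
have Pk i m : P (x 0 i ^+ m) (y 0 i ^+ m) m.
  elim: m => [|m IH]; first by rewrite !expr0.
  rewrite !exprS -[m.+1]/(1 + m)%N; apply: PM => //; split; rewrite ?expr1// mulr1.
  exact: xy.
have [_ _ /le_trans] : P (\prod_(i < n) x 0 i ^+ k i) (\prod_(i < n) y 0 i ^+ k i)
    (\sum_(i < n) k i)%N.
  by elim/big_rec3: _ => // i m b a _; exact: PM.
apply; rewrite exprMn -mulrA ler_wpM2l// ler_wpM2r ?exprn_ge0 1?ltW//.
by rewrite -natrX ltr_nat ltn_expl.
Qed.

Lemma analytic_at_lipschitz (R : realType) (n : nat) (f : 'rV[R]_n -> R)
    (a : 'rV[R]_n) :
  analytic_at f a ->
  exists e M : R, [/\ 0 < e, 0 < M &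
  forall x y : 'rV[R]_n, (forall i, `|x 0 i - a 0 i| <= e) ->
    (forall i, `|y 0 i - a 0 i| <= e) ->
    `|f x| <= M /\
    forall E, 0 <= E -> (forall i, `|x 0 i - y 0 i| <= E) ->
      `|f x - f y| <= M * E].
Proof.
move=> /analytic_functional_bound[rho [A [rho0 A0 fA]]].
have A2 : 0 < 2 * A / rho by rewrite divr_gt0 ?mulr_gt0.
exists (rho / 2), (A + 2 * A / rho); split; [lra|lra|move=> x y xa ya; split].
  have := fA [:: (1, x - a)] 1 ler01; rewrite !big_seq1/= subrKC !mul1r.
  move=> /(_ _ _)/le_trans; apply; last by lra.
  - by move=> wx /[!inE]/eqP-> i /=; rewrite !mxE; apply: le_trans (xa i) _; lra.
  - move=> k; rewrite big_seq1/= !mul1r normr_prod expr_sum.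
    apply: ler_prod => i _; rewrite normr_ge0 normrX/= lerXn2r ?nnegrE//.
      by rewrite ltW.
    by rewrite !mxE; apply: le_trans (xa i) _; lra.
move=> E E0 xyE.
have := fA [:: (1, x - a); (-1, y - a)] (E * (2 / rho)).
rewrite !big_cons !big_nil/= !subrKC addr0 mul1r mulN1r => H.
apply: le_trans (H _ _ _) _ => {H}.
- by rewrite mulr_ge0// divr_ge0// ltW.
- by move=> wx /[!inE]/orP[]/eqP-> i /=; rewrite !mxE;
    [apply: le_trans (xa i) _|apply: le_trans (ya i) _]; lra.
- move=> k; rewrite !big_cons !big_nil/= addr0 mul1r mulN1r.
  have -> : rho = 2 * (rho / 2) by field.
  have -> : E * (2 / (2 * (rho / 2))) = E * (2 / rho) by congr (_ * (_ / _)); field.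
  apply: monomial_lipschitz; first lra.
  + by rewrite mulr_ge0// divr_ge0// ltW.
  + by move=> i; rewrite !mxE.
  + by move=> i; rewrite !mxE.
  + move=> i; rewrite !mxE (_ : E * (2 / rho) * (rho / 2) = E); last by field; rewrite gt_eqF.
    by rewrite opprB addrA subrK.
- rewrite mulrDl (_ : E * _ * A = 2 * A / rho * E); last by ring.
  by rewrite ler_wpM2r//; lra.
Qed.

(** Moves x along the first coordinate towards the hyperplane through a. *)
Definition scale0 (R : realType) (n : nat) (a x : 'rV[R]_n.+1) (s : R) : 'rV[R]_n.+1 :=
  \row_i (if i == 0 then a 0 0 + s * (x 0 0 - a 0 0) else x 0 i).

(** The increment of f in the first coordinate is linear up to second order, and
    the slope is measured here by the increment at the scaled point. The
    combination kills the monomials of degree 0 and 1 in the first coordinate, so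
    no series for the partial derivative is needed: when f vanishes on the
    hyperplane, letting t tend to 0 compares f with its slope there. *)
Lemma analytic_at_scaling (R : realType) (n : nat) (f : 'rV[R]_n.+1 -> R)
    (a : 'rV[R]_n.+1) :
  analytic_at f a ->
  exists e M : R, [/\ 0 < e, 0 < M &
  forall (x : 'rV[R]_n.+1) (t : R), (forall i, `|x 0 i - a 0 i| <= e) ->
    0 < t <= 1 ->
    `|f x - f (scale0 a x 0) - t^-1 * (f (scale0 a x t) - f (scale0 a x 0))|
      <= M * (x 0 0 - a 0 0) ^+ 2].
Proof.
move=> /analytic_functional_bound[rho [A [rho0 A0 fA]]].
exists rho, (A / rho ^+ 2); split; [lra|by rewrite divr_gt0 ?exprn_gt0|].
move=> x t xa /andP[t0 t1]; set sc := scale0 a x.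
have sca s i : (sc s - a) 0 i = if i == 0 then s * (x 0 0 - a 0 0) else x 0 i - a 0 i.
  by rewrite !mxE; case: eqP => [->|//]; rewrite addrAC subrr add0r.
have E0 : 0 <= (x 0 0 - a 0 0) ^+ 2 / rho ^+ 2.
  by rewrite divr_ge0 ?sqr_ge0// exprn_ge0// ltW.
have := fA [:: (1, x - a); (-1, sc 0 - a); (- t^-1, sc t - a); (t^-1, sc 0 - a)] _ E0.
rewrite !big_cons !big_nil/= !subrKC addr0 => H.
have -> : f x - f (sc 0) - t^-1 * (f (sc t) - f (sc 0)) =
   1 * f x + (-1 * f (sc 0) + (- t^-1 * f (sc t) + t^-1 * f (sc 0))) by ring.
rewrite [leRHS]mulrAC -[leRHS]mulrA [leRHS]mulrC; apply: H.
  have scr s : 0 <= s <= 1 -> forall i, `|(sc s - a) 0 i| <= rho.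
    move=> /andP[s0 s1] i; rewrite sca; case: eqP => // _.
    by rewrite normrM (ger0_norm s0); apply: le_trans (xa 0); rewrite ler_piMl.
  move=> wx /[!inE]/or4P[]/eqP-> /=.
  - by move=> i; rewrite !mxE.
  - by apply: scr; lra.
  - by apply: scr; lra.
  - by apply: scr; lra.
move=> k; rewrite !big_cons !big_nil/= addr0 !big_ord_recl.
set y0 := x 0 0 - a 0 0.
have xa0 : (x - a) 0 0 = y0 by rewrite !mxE.
rewrite !sca xa0/=.
set P := \prod_(i < n) (x - a) 0 (lift ord0 i) ^+ k (lift ord0 i).
have PE s : \prod_(i < n) (sc s - a) 0 (lift ord0 i) ^+ k (lift ord0 i) = P.
  by apply: eq_bigr => i _; rewrite sca/= !mxE.
rewrite !PE mul0r -/y0.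
have Pr : `|P| <= rho ^+ (\sum_(i < n) k (lift ord0 i))%N.
  rewrite normr_prod expr_sum.
  apply: ler_prod => i _; rewrite normr_ge0 normrX/= lerXn2r ?nnegrE//.
    by rewrite ltW.
  by rewrite !mxE.
have rho_ge0 m : 0 <= rho ^+ m by rewrite exprn_ge0// ltW.
rewrite exprD; case: (k ord0) => [|[|m]].
- rewrite !expr0.
  rewrite (_ : _ + _ = 0); last by ring.
  by rewrite normr0 mulr_ge0// mulr_ge0// ltW.
- rewrite !expr1.
  rewrite (_ : _ + _ = 0); last by field; rewrite gt_eqF.
  by rewrite normr0 mulr_ge0// mulr_ge0// ltW.
- have -> : 1 * (y0 ^+ m.+2 * P) + (-1 * (0 ^+ m.+2 * P) + (- t^-1 * ((t * y0) ^+ m.+2 * P) +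
      t^-1 * (0 ^+ m.+2 * P))) = (y0 ^+ 2 * (y0 ^+ m * (1 - t ^+ m.+1))) * P.
    by rewrite !exprSr !mulr0 exprMn; field; rewrite gt_eqF.
  rewrite normrM [leRHS]mulrA ler_pM// normrM ger0_norm ?sqr_ge0//.
  rewrite -[leRHS]mulrA ler_wpM2l ?sqr_ge0//.
  rewrite (_ : _ ^-1 * _ = rho ^+ m); last first.
    by rewrite -[m.+2]/(2 + m)%N exprD mulKf// expf_neq0// gt_eqF.
  rewrite normrM -[leRHS]mulr1 ler_pM//.
    by rewrite normrX lerXn2r ?nnegrE ?xa// ltW.
  have u0 : 0 <= t ^+ m.+1 by rewrite exprn_ge0// ltW.
  have u1 : t ^+ m.+1 <= 1 by rewrite exprn_ile1// ltW.
  by rewrite ger0_norm; lra.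
Qed.
(** * Uniformity over compact boxes *)

Lemma near_coord (R : realType) (n : nat) (a : 'rV[R]_n) (e : R) : 0 < e ->
  \forall x \near a, forall i, `|(x : 'rV[R]_n) 0 i - a 0 i| <= e.
Proof.
move=> e0.
suff H i : \forall x \near a, `|(x : 'rV[R]_n) 0 i - a 0 i| <= e.
  exact: (filter_forall (nbhs_filter a) H).
have /cvgr_dist_le/(_ e e0) := @coord_continuous R 1 n 0 i a.
by apply: filterS => x; rewrite distrC.
Qed.

(** Local statements with a constant that may be enlarged become uniform. *)
Lemma compact_uniform (R : realType) (n : nat) (K : set 'rV[R]_n)
    (Q : R -> 'rV[R]_n -> Prop) : compact K ->
  (forall a, K a -> exists e M : R, 0 < e /\ forall x m, K x ->
     (forall i, `|x 0 i - a 0 i| <= e) -> M <= m -> Q m x) ->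
  exists2 M : R, 0 < M & forall x, K x -> Q M x.
Proof.
move=> /compact_near_coveringP cK loc_Q.
have /pinfty_ex_gt0[M M0 MQ] : \forall m \near +oo, K `<=` (fun x => K x -> Q m x).
  apply: cK => a /loc_Q[e [M [e0 eM]]].
  exists ([set x : 'rV[R]_n | forall i, `|x 0 i - a 0 i| <= e], [set m | M <= m]).
    by split; [exact: near_coord | exact: nbhs_pinfty_ge (num_real M)].
  by move=> [x m] [/= xa mM] Kx; exact: eM.
by exists M => // x Kx; exact: MQ.
Qed.

(** The Lipschitz estimate is restricted to short distances, where both points lie
    in a single neighborhood on which the constant is valid. *)
Lemma compact_analytic_lipschitz (R : realType) (n : nat) (f : 'rV[R]_n -> R)
    (A : 'I_n -> set R) :
  (forall i, compact (A i)) ->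
  (forall a : 'rV[R]_n, (forall i, A i (a 0 i)) -> analytic_at f a) ->
  exists2 M : R, 0 < M & forall x : 'rV[R]_n, (forall i, A i (x 0 i)) ->
    `|f x| <= M /\
    forall (y : 'rV[R]_n) E, 0 <= E < M^-1 -> (forall i, `|x 0 i - y 0 i| <= E) ->
      `|f x - f y| <= M * E.
Proof.
move=> cA fan.
have := @compact_uniform R n [set v | forall i, A i (v 0 i)]
  (fun M x => `|f x| <= M /\
    forall (y : 'rV[R]_n) E, 0 <= E < M^-1 -> (forall i, `|x 0 i - y 0 i| <= E) ->
      `|f x - f y| <= M * E) (rV_compact cA).
apply => a /fan/analytic_at_lipschitz[e [M [e0 M0 eM]]].
exists (e / 2), (M + 2 / e); split; first by rewrite divr_gt0.
move=> x m _ xa Mm.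
have e2 : 0 < 2 / e by rewrite divr_gt0.
split.
  have xe i : `|x 0 i - a 0 i| <= e by apply: le_trans (xa i) _; lra.
  by have [xM _] := eM x x xe xe; apply: le_trans xM _; lra.
move=> y E /andP[E0 Em] xyE.
have Ee : E <= e / 2.
  apply: ltW; apply: lt_le_trans Em _.
  by rewrite -[e / 2]invrK lef_pV2 ?posrE; [rewrite invf_div|..]; rewrite ?invr_gt0; lra.
have [] := eM x y.
- by move=> i; apply: le_trans (xa i) _; lra.
- move=> i; rewrite (_ : y 0 i - a 0 i = (x 0 i - a 0 i) - (x 0 i - y 0 i)); last by ring.
  apply: le_trans (ler_normB _ _) _; have := xa i; have := xyE i; lra.
move=> _ /(_ E E0 xyE) /le_trans; apply.
by rewrite ler_wpM2r//; lra.
Qed.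
(** At distances above 1 / M the sup bound replaces the local estimate. *)
Lemma segment_analytic_lipschitz (R : realType) (f : R -> R) (a b : R) :
  (forall x, a <= x <= b -> analytic1_at f x) ->
  exists2 M : R, 0 < M & forall x y, a <= x <= b -> a <= y <= b ->
    `|f x| <= M /\ `|f x - f y| <= M * `|x - y|.
Proof.
move=> fan.
have [|c Kc|M M0 fM] := @compact_analytic_lipschitz R 1 (fun x => f (x 0 0))
  (fun=> `[a, b]%classic).
- by move=> _; exact: segment_compact.
- have -> : c = vec [:: c 0 0] by apply/rowP => i; rewrite mxE ord1.
  by apply: fan; have /= := Kc 0; rewrite in_itv.
have vecE x : (vec [:: x] : 'rV[R]_1) 0 0 = x by rewrite mxE.
exists (M + M * M * 2) => [|x y xab yab]; first by rewrite addr_gt0 ?mulr_gt0.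
have MM : 0 < M * M by rewrite mulr_gt0.
have fx z : a <= z <= b -> `|f z| <= M /\ forall w E, 0 <= E < M^-1 -> `|z - w| <= E ->
    `|f z - f w| <= M * E.
  move=> zab; have [i|] := fM (vec [:: z] : 'rV[R]_1).
    by rewrite ord1 vecE /= in_itv/=.
  rewrite vecE => zM zL; split => // w E E0 zw.
  have := zL (vec [:: w] : 'rV[R]_1) E E0; rewrite vecE; apply => i.
  by rewrite ord1 !vecE.
have [xM xL] := fx x xab; have [yM _] := fx y yab.
split; first by lra.
have [xy|xy] := ltP `|x - y| M^-1.
  apply: le_trans (xL y `|x - y| _ (lexx _)) _; first by rewrite normr_ge0.
  by rewrite ler_wpM2r//; lra.
have : 1 <= M * `|x - y| by rewrite -ler_pdivrMl// mulr1.
have := ler_normB (f x) (f y).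
rewrite mulrDl => ? h1.
have : M * 2 * 1 <= M * 2 * (M * `|x - y|) by rewrite ler_wpM2l//; lra.
have : 0 <= M * `|x - y| by lra.
nra.
Qed.

Lemma lipschitz_gt0_bound (R : realType) (f : R -> R) (M a b : R) :
  (forall x y, a <= x <= b -> a <= y <= b -> `|f x - f y| <= M * `|x - y|) ->
  (forall x, a <= x <= b -> 0 < f x) ->
  exists2 mu : R, 0 < mu & forall x, a <= x <= b -> mu <= f x.
Proof.
move=> fL f0.
have [c Kc|M1 M10 M1f] := @compact_uniform R 1
    [set v : 'rV[R]_1 | forall i, `[a, b]%classic (v 0 i)]
    (fun m (x : 'rV[R]_1) => m^-1 <= f (x 0 0))
    (rV_compact (fun=> @segment_compact R a b)).
  move: (Kc 0); rewrite /= in_itv/= => cab.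
  have fc := f0 _ cab.
  have MM : 0 < `|M| + 1 by rewrite ltr_wpDl.
  exists (f (c 0 0) / 2 / (`|M| + 1)), (f (c 0 0) / 2)^-1; split.
    by rewrite !divr_gt0.
  move=> x m /(_ 0); rewrite /= in_itv/= => xab /(_ 0) xc mf.
  have m0 : 0 < m by apply: lt_le_trans mf; rewrite invr_gt0; lra.
  apply: (@le_trans _ _ (f (c 0 0) / 2)).
    by rewrite -[leRHS]invrK lef_pV2 ?posrE// invr_gt0; lra.
  have := fL _ _ xab cab.
  have : M * `|x 0 0 - c 0 0| <= f (c 0 0) / 2.
    apply: (@le_trans _ _ ((`|M| + 1) * `|x 0 0 - c 0 0|)).
      by rewrite ler_wpM2r//; have := ler_norm M; lra.
    by rewrite mulrC -ler_pdivlMr.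
  by rewrite ler_distl; lra.
exists M1^-1; first by rewrite invr_gt0.
move=> x xab; have := M1f (const_mx x); rewrite mxE; apply => i.
by rewrite mxE /= in_itv.
Qed.

(** The increment c is 0 for periodic functions and the degree for lifts of
    circle-valued maps. *)
Lemma increment_int (R : realType) (g : R -> R) (c : R) :
  (forall u, g (u + 1) = g u + c) ->
  forall (k : int) u, g (u + k%:~R) = g u + c * k%:~R.
Proof.
move=> g1.
have gn (n : nat) u : g (u + n%:R) = g u + c * n%:R.
  elim: n => [|n IH]; first by rewrite !addr0 mulr0 addr0.
  by rewrite -addn1 natrD addrA g1 IH; ring.
case=> n u; first exact: gn.
by have := gn n.+1 (u + (Negz n)%:~R); rewrite NegzE mulrNz subrK => ->; ring.
Qed.
(** * Constants of the local system *)

Lemma row4E (R : realType) (x : 'rV[R]_4) :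
  x = vec [:: x 0 0; x 0 1; x 0 2%R; x 0 3%R].
Proof.
by apply/rowP => -[[|[|[|[|//]]]] ?]; rewrite mxE /=; congr (x _ _); exact: val_inj.
Qed.

Definition box (R : realType) (H d v1 v2 r : R) :=
  [/\ `|v1| <= H, `|v2| <= H & - d <= r <= 1 + d].

Definition rate_bound (R : realType) (d M : R) (f : R -> R) :=
  forall x y, - d <= x <= 1 + d -> - d <= y <= 1 + d ->
    `|f x| <= M /\ `|f x - f y| <= M * `|x - y|.

Definition coef_bound (R : realType) (H d M : R) (f : 'rV[R]_4 -> R) :=
  forall v1 v2 r phi, box H d v1 v2 r ->
    `|f (vec [:: v1; v2; r; phi])| <= M /\
    forall w1 w2 s psi E, box H d w1 w2 s ->
      `|v1 - w1| <= E -> `|v2 - w2| <= E -> `|r - s| <= E -> `|phi - psi| <= E ->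
      `|f (vec [:: v1; v2; r; phi]) - f (vec [:: w1; w2; s; psi])| <= M * E.

(** Periodicity in phi brings the first point to the compact cell 0 <= phi <= 1;
    the second point is shifted by the same integer. *)
Lemma coef_lipschitz (R : realType) (f : 'rV[R]_4 -> R) (H d : R) :
  (forall v1 v2 r phi, box H d v1 v2 r -> analytic_at f (vec [:: v1; v2; r; phi])) ->
  (forall v1 v2 r phi, box H d v1 v2 r ->
     f (vec [:: v1; v2; r; phi + 1]) = f (vec [:: v1; v2; r; phi])) ->
  exists2 M : R, 0 < M & coef_bound H d M f.
Proof.
move=> fan fper.
pose A (i : 'I_4) : set R := nth `[0, 1]%classic
  [:: `[- H, H]%classic; `[- H, H]%classic; `[- d, 1 + d]%classic] i.
have cA i : compact (A i) by case: i => -[|[|[|[|//]]]] ? /=; exact: segment_compact.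
have AP v1 v2 r phi : box H d v1 v2 r -> 0 <= phi <= 1 ->
    forall i, A i ((vec [:: v1; v2; r; phi] : 'rV[R]_4) 0 i).
  move=> [h1 h2 h3] h4 [[|[|[|[|//]]]] ?]; rewrite mxE/A/= in_itv/= //.
  - by rewrite -ler_norml.
  - by rewrite -ler_norml.
have [x Ax|M M0 fM] := compact_analytic_lipschitz cA (f := f).
  rewrite (row4E x); apply: fan.
  have := Ax 0; have := Ax 1; have := Ax 2%R; rewrite /A/= !in_itv/= => ? ? ?.
  by split => //; rewrite ler_norml.
have fz (k : int) v1 v2 r phi : box H d v1 v2 r ->
    f (vec [:: v1; v2; r; phi + k%:~R]) = f (vec [:: v1; v2; r; phi]).
  move=> b; have := @increment_int R (fun u => f (vec [:: v1; v2; r; u])) 0 _ k phi.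
  by rewrite mul0r addr0; apply => u; rewrite addr0; exact: fper.
have bnd v1 v2 r phi : box H d v1 v2 r -> `|f (vec [:: v1; v2; r; phi])| <= M /\
    forall w1 w2 s psi E, box H d w1 w2 s -> 0 <= E < M^-1 ->
      `|v1 - w1| <= E -> `|v2 - w2| <= E -> `|r - s| <= E -> `|phi - psi| <= E ->
      `|f (vec [:: v1; v2; r; phi]) - f (vec [:: w1; w2; s; psi])| <= M * E.
  move=> b; pose k := - Num.floor phi.
  have kphi : 0 <= phi + k%:~R <= 1.
    have := floor_le phi; have := floorD1_gt phi; rewrite /k mulrNz intrD.
    lra.
  have [fb fl] := fM _ (AP _ _ _ _ b kphi).
  rewrite -(fz k)//; split => // w1 w2 s psi E bw Eb h1 h2 h3 h4.
  rewrite -(fz k w1)//; apply: fl Eb _.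
  move=> [[|[|[|[|//]]]] ?]; rewrite !mxE//=.
  by rewrite opprD addrACA subrr addr0.
have MM : 0 < M * M by rewrite mulr_gt0.
exists (M + 2 * (M * M)); first by lra.
move=> v1 v2 r phi b; have [fb fl] := bnd v1 v2 r phi b.
split; first by lra.
move=> w1 w2 s psi E bw h1 h2 h3 h4.
have E0 : 0 <= E := le_trans (normr_ge0 _) h1.
have [EM|EM] := ltP E M^-1.
  apply: le_trans (fl _ _ _ _ _ bw _ h1 h2 h3 h4) _; first by rewrite E0.
  by rewrite ler_wpM2r//; lra.
have : 1 <= M * E by rewrite -ler_pdivrMl// mulr1.
have [fw _] := bnd w1 w2 s psi bw.
have := ler_normB (f (vec [:: v1; v2; r; phi])) (f (vec [:: w1; w2; s; psi])).
move=> n1 n2.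
have : M * 1 <= M * (M * E) by rewrite ler_wpM2l// ltW.
by move=> n3; rewrite mulrDl -!mulrA; lra.
Qed.
(** A working box around D. On it the vector field is bounded and Lipschitz, and
    the logarithmic derivatives of v1, v2 and u = v1 v2 keep the signs that they
    have on D. *)
Record tame (R : realType) (X : local_system R) (H d mu M : R) : Prop := Tame {
  tame_H : 0 < H < delta X;
  tame_d : 0 < d < delta X;
  tame_mu : 0 < mu;
  tame_M : 0 < M;
  tame_rate : [/\ rate_bound d M (p X), rate_bound d M (sigma X) &
    rate_bound d M (omega X)];
  tame_coef : [/\ coef_bound H d M (p0 X), coef_bound H d M (sigma0 X),
    coef_bound H d M (r0 X) & coef_bound H d M (omega0 X)];
  tame_sign : forall v1 v2 r phi, box H d v1 v2 r ->
    let x := vec [:: v1; v2; r; phi] in let u := v1 * v2 in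
    [/\ mu <= p X r + u * p0 X x, sigma X r + u * sigma0 X x <= - mu &
        p X r + u * p0 X x + (sigma X r + u * sigma0 X x) <= - mu] }.

Lemma rate_boundS (R : realType) (d d' M M' : R) (f : R -> R) :
  d' <= d -> M <= M' -> rate_bound d M f -> rate_bound d' M' f.
Proof.
move=> dd MM fb x y xd yd; have [||fM fL] := fb x y; [lra|lra|].
split; first lra.
by apply: le_trans fL _; rewrite ler_wpM2r.
Qed.

Lemma coef_boundS (R : realType) (H H' d d' M M' : R) (f : 'rV[R]_4 -> R) :
  H' <= H -> d' <= d -> M <= M' -> coef_bound H d M f -> coef_bound H' d' M' f.
Proof.
move=> HH dd MM fb v1 v2 r phi b.
have bS w1 w2 s : box H' d' w1 w2 s -> box H d w1 w2 s by move=> [? ? ?]; split; lra.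
have [fM fL] := fb v1 v2 r phi (bS _ _ _ b).
split; first lra.
move=> w1 w2 s psi E bw h1 h2 h3 h4.
apply: le_trans (fL _ _ _ _ _ (bS _ _ _ bw) h1 h2 h3 h4) _.
by rewrite ler_wpM2r// (le_trans _ h1).
Qed.

Lemma dist_unit_segment (R : realType) (r d : R) : 0 <= d ->
  - d <= r <= 1 + d ->
  exists2 q : R, 0 <= q <= 1 & `|r - q| <= d.
Proof.
move=> d0 rd; have [r1|r1] := ltP 1 r.
  by exists 1; [lra|rewrite ger0_norm; lra].
have [r0|r0] := leP 0 r; first by exists r; [lra|rewrite subrr normr0; lra].
by exists 0; [lra|rewrite subr0 ltr0_norm; lra].
Qed.

(** By compactness of [0, 1] the three rates stay at distance 4 mu from 0. Leaving
    [0, 1] by at most d costs at most mu for each of p and sigma, and the terms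
    u p0 and u sigma0 cost mu / 2 each. *)
Lemma tame_exists (R : realType) (X : local_system R) :
  exists H d mu M : R, tame X H d mu M.
Proof.
have de0 := delta_gt0 X.
pose D := delta X / 2.
have rateP (f : R -> R) : (forall r, - delta X < r < 1 + delta X -> analytic1_at f r) ->
    exists2 M, 0 < M & rate_bound D M f.
  move=> fan; apply: segment_analytic_lipschitz => x xD; apply: fan.
  by rewrite /D in xD; lra.
have boxD v1 v2 r : box D D v1 v2 r -> in_chart X v1 v2 r.
  by rewrite /D => -[? ? ?]; split; lra.
have [r /rate_analytic[]//|M1 M1_0 pb] := rateP (p X).
have [r /rate_analytic[]//|M2 M2_0 sb] := rateP (sigma X).
have [r /rate_analytic[]//|M3 M3_0 ob] := rateP (omega X).
have [v1 v2 r phi /boxD/(coef_analytic phi)[]//|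
  v1 v2 r phi /boxD/(coef_periodic phi)[]//|M4 M4_0 p0b] :=
  @coef_lipschitz R (p0 X) D D.
have [v1 v2 r phi /boxD/(coef_analytic phi)[]//|
  v1 v2 r phi /boxD/(coef_periodic phi)[]//|M5 M5_0 s0b] :=
  @coef_lipschitz R (sigma0 X) D D.
have [v1 v2 r phi /boxD/(coef_analytic phi)[]//|
  v1 v2 r phi /boxD/(coef_periodic phi)[]//|M6 M6_0 r0b] :=
  @coef_lipschitz R (r0 X) D D.
have [v1 v2 r phi /boxD/(coef_analytic phi)[]//|
  v1 v2 r phi /boxD/(coef_periodic phi)[]//|M7 M7_0 o0b] :=
  @coef_lipschitz R (omega0 X) D D.
pose M := M1 + M2 + M3 + M4 + M5 + M6 + M7.
have M0 : 0 < M by rewrite /M; lra.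
have D0 : 0 < D by rewrite /D; lra.
have {}pb : rate_bound D M (p X) by apply: rate_boundS pb => //; rewrite /M; lra.
have {}sb : rate_bound D M (sigma X) by apply: rate_boundS sb => //; rewrite /M; lra.
have {}ob : rate_bound D M (omega X) by apply: rate_boundS ob => //; rewrite /M; lra.
have {}p0b : coef_bound D D M (p0 X) by apply: coef_boundS p0b => //; rewrite /M; lra.
have {}s0b : coef_bound D D M (sigma0 X) by apply: coef_boundS s0b => //; rewrite /M; lra.
have {}r0b : coef_bound D D M (r0 X) by apply: coef_boundS r0b => //; rewrite /M; lra.
have {}o0b : coef_bound D D M (omega0 X) by apply: coef_boundS o0b => //; rewrite /M; lra.
have posP (f : R -> R) : (forall x y, - D <= x <= 1 + D -> - D <= y <= 1 + D ->
      `|f x - f y| <= 2 * M * `|x - y|) -> (forall r, 0 <= r <= 1 -> 0 < f r) ->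
    exists2 nu, 0 < nu & forall r, 0 <= r <= 1 -> nu <= f r.
  move=> fL; apply: lipschitz_gt0_bound => x y x01 y01; apply: fL; lra.
have pL x y : - D <= x <= 1 + D -> - D <= y <= 1 + D ->
    `|p X x - p X y| <= M * `|x - y| by move=> h1 h2; have [] := pb x y h1 h2.
have sL x y : - D <= x <= 1 + D -> - D <= y <= 1 + D ->
    `|sigma X x - sigma X y| <= M * `|x - y| by move=> h1 h2; have [] := sb x y h1 h2.
have [||n1 n1_0 pn] := posP (p X).
- move=> x y hx hy; have := pL x y hx hy; have : 0 <= M * `|x - y| by rewrite mulr_ge0// ltW.
  lra.
- by move=> r /(rate_sign X)[].
have [||n2 n2_0 sn] := posP (fun r => - sigma X r).
- move=> x y hx hy; have := sL x y hx hy; have : 0 <= M * `|x - y| by rewrite mulr_ge0// ltW.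
  by rewrite -opprD normrN; lra.
- by move=> r /(rate_sign X)[]; rewrite oppr_gt0.
have [||n3 n3_0 psn] := posP (fun r => - (p X r + sigma X r)).
- move=> x y hx hy; have := sL x y hx hy; have := pL x y hx hy.
  rewrite -opprD normrN opprD addrACA.
  have := ler_normD (p X x - p X y) (sigma X x - sigma X y); lra.
- by move=> r /(rate_sign X)[]; rewrite oppr_gt0.
pose nu := Num.min n1 (Num.min n2 n3).
have [nn1 nn2 nn3] : [/\ nu <= n1, nu <= n2 & nu <= n3].
  by split; rewrite /nu !ge_min lexx ?orbT.
have nu0 : 0 < nu by rewrite /nu !lt_min n1_0 n2_0.
pose mu := nu / 4.
have mu0 : 0 < mu by rewrite /mu; lra.
pose d := Num.min D (mu / M).
have d0 : 0 < d by rewrite lt_min D0 divr_gt0.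
have dD : d <= D by rewrite ge_min lexx.
have Md : M * d <= mu.
  by rewrite mulrC -ler_pdivlMr// ge_min lexx orbT.
pose H := Num.min D (Num.min 1 (mu / (2 * M))).
have H0 : 0 < H by rewrite !lt_min D0 ltr01 divr_gt0// mulr_gt0.
have HD : H <= D by rewrite ge_min lexx.
have H1 : H <= 1 by rewrite /H !ge_min lexx !orbT.
have HM : 2 * M * H <= mu.
  by rewrite mulrC -ler_pdivlMr ?mulr_gt0// /H !ge_min lexx !orbT.
have DX : D < delta X by rewrite /D; lra.
exists H, d, mu, M; split => //.
- by rewrite H0 (le_lt_trans HD).
- by rewrite d0 (le_lt_trans dD).

- by split; [apply: rate_boundS pb|apply: rate_boundS sb|apply: rate_boundS ob].
- by split; [apply: coef_boundS p0b|apply: coef_boundS s0b|apply: coef_boundS r0b|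
  apply: coef_boundS o0b].
move=> v1 v2 r phi [b1 b2 b3].
have bD : box D D v1 v2 r.
  by split; [exact: le_trans HD|exact: le_trans HD|clear -b3 dD; lra].
have [p0M _] := p0b v1 v2 r phi bD; have [s0M _] := s0b v1 v2 r phi bD.
move=> x u.
have uH : `|u| <= H.
  by rewrite normrM -[leRHS]mulr1 ler_pM// (le_trans b2).
have uP c : `|c| <= M -> `|u * c| <= mu / 2.
  move=> cM; rewrite normrM; apply: (@le_trans _ _ (H * M)); first by rewrite ler_pM.
  by clear -HM; lra.
have := uP _ p0M; have := uP _ s0M; rewrite !ler_norml -/x => su pu.
have [q q01 rq] := dist_unit_segment (ltW d0) b3.
have Mrq : M * `|r - q| <= mu by apply: le_trans Md; rewrite ler_pM2l.
have hr : - D <= r <= 1 + D by case: bD.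
have hq : - D <= q <= 1 + D by clear -q01 D0; lra.
have := pL r q hr hq; have := sL r q hr hq; rewrite !ler_distl => sr pr.
have := pn q q01; have := sn q q01; have := psn q q01.
have nuE : nu = 4 * mu by rewrite /mu; field.
by clear -nuE nn1 nn2 nn3 Mrq sr pr su pu mu0 => ? ? ?; split; lra.
Qed.
(** * Comparison of derivatives *)

Lemma is_derive_continuous (R : realType) (f : R -> R) (t l : R) :
  is_derive t 1 f l -> {for t, continuous f}.
Proof. by move=> [/derivable1_diffP df _]; exact: differentiable_continuous df. Qed.

Lemma derive_le_increment (R : realType) (f g df dg : R -> R) (T : R) : 0 <= T ->
  {within `[0, T], continuous f} -> {within `[0, T], continuous g} ->
  (forall t, 0 < t < T -> [/\ is_derive t 1 f (df t), is_derive t 1 g (dg t) &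
     df t <= dg t]) ->
  f T - f 0 <= g T - g 0.
Proof.
rewrite le_eqVlt => /predU1P[<- _ _ _|T0 cf cg dfg]; first by rewrite !subrr.
have [t tT|c|c c0T] := @MVT R (fun t => g t - f t) (fun t => dg t - df t) 0 T T0.
- have [] := dfg t; first by move: tT; rewrite in_itv.
  by move=> ? ? _; exact: is_deriveB.
- by apply: continuousB; [exact: cg|exact: cf].
move: c0T; rewrite in_itv/= => c0T E; have [_ _ le] := dfg c c0T.
have : 0 <= (dg c - df c) * (T - 0) by rewrite mulr_ge0//; lra.
by lra.
Qed.

Lemma derive_norm_le_increment (R : realType) (f g df dg : R -> R) (T : R) : 0 <= T ->
  {within `[0, T], continuous f} -> {within `[0, T], continuous g} ->
  (forall t, 0 < t < T -> [/\ is_derive t 1 f (df t), is_derive t 1 g (dg t) &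
     `|df t| <= dg t]) ->
  `|f T - f 0| <= g T - g 0.
Proof.
move=> T0 cf cg dfg; rewrite ler_norml; apply/andP; split; last first.
  apply: (@derive_le_increment _ f g df dg) => // t /dfg[? ? ?]; split => //.
  by apply: le_trans (ler_norm _) _.
have := @derive_le_increment _ (fun t => - f t) g (fun t => - df t) dg T T0.
have -> : - f T - - f 0 = - (f T - f 0) by ring.
rewrite lerNl; apply => //.
  by move=> x; apply: continuousN; exact: cf.
move=> t /dfg[? ? h]; split => //; first exact: is_deriveN.
by apply: le_trans h; rewrite -normrN ler_norm.
Qed.

(** * Global existence for Lipschitz vector fields *)

(** The base point -1 makes the primitive two-sided differentiable at 0. *)
Definition primitive (R : realType) (g : R -> R) (t : R) : R :=
  \int[lebesgue_measure]_(s in `[-1, t]) g s - \int[lebesgue_measure]_(s in `[-1, 0]) g s.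

Lemma primitive0 (R : realType) (g : R -> R) : primitive g 0 = 0.
Proof. exact: subrr. Qed.

Lemma is_derive_primitive (R : realType) (g : R -> R) (t : R) :
  continuous g -> 0 <= t -> is_derive t 1 (primitive g) (g t).
Proof.
move=> cg t0.
have tt1 : t < t + 1 by lra.
have ig : lebesgue_measure.-integrable `[-1, t + 1] (EFin \o g).
  apply: continuous_compact_integrable; first exact: segment_compact.
  exact: continuous_subspaceT.
have t1 : -1 < t by lra.
have [dp pE] := continuous_FTC1_closed tt1 ig t1 (cg t).
rewrite /primitive -[g t]subr0; apply: is_deriveB.
by apply: DeriveDef; [exact: dp|rewrite -derive1E; exact: pE].
Qed.

(** The intervals of radius 2 A 2^-n around a_n are nested, and l is the supremum
    of their left ends. *)
Lemma geometric_limit (R : realType) (a : nat -> R) (A : R) :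
  (forall n, `|a n.+1 - a n| <= A * 2 ^- n) ->
  exists l, forall n, `|l - a n| <= 2 * A * 2 ^- n.
Proof.
move=> aA.
have A0 : 0 <= A by have := aA 0%N; rewrite expr0 invr1 mulr1; exact: le_trans.
pose e n := 2 * A * 2 ^- n.
have e0 n : 0 <= e n by rewrite !mulr_ge0// invr_ge0 exprn_ge0.
have eS n : e n = e n.+1 + A * 2 ^- n by rewrite /e exprS invfM; field; rewrite expf_neq0.
have step n : a n - e n <= a n.+1 - e n.+1 /\ a n.+1 + e n.+1 <= a n + e n.
  by have := aA n; rewrite ler_distl (eS n) => /andP[? ?]; split; lra.
have lo n k : a n - e n <= a (n + k)%N - e (n + k)%N.
  elim: k => [|k IH]; first by rewrite addn0.
  by rewrite addnS (le_trans IH)// (step _).1.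
have hi n k : a (n + k)%N + e (n + k)%N <= a n + e n.
  elim: k => [|k IH]; first by rewrite addn0.
  by rewrite addnS (le_trans (step _).2).
have lohi n m : a n - e n <= a m + e m.
  have [nm|mn] := leqP n m.
    have := lo n (m - n)%N; have := hi m 0%N; rewrite addn0 subnKC//; have := e0 m; lra.
  have := hi m (n - m)%N; rewrite subnKC 1?ltnW//; have := e0 n; lra.
exists (sup (range (fun n => a n - e n))) => n; rewrite ler_distl; apply/andP; split.
  apply: ub_le_sup; last by exists n.
  by exists (a 0%N + e 0%N) => _ [m _ <-].
by apply: ge_sup; [exists (a 0%N - e 0%N), 0%N|move=> _ [m _ <-]].
Qed.
Definition coord_lipschitz (R : realType) (n : nat) (L : R)
    (F : ('I_n -> R) -> 'I_n -> R) :=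
  forall x y E, (forall i, `|x i - y i| <= E) -> forall i, `|F x i - F y i| <= L * E.

Lemma is_derive_mul (R : realType) (f g : R -> R) (t df dg : R) :
  is_derive t 1 f df -> is_derive t 1 g dg ->
  is_derive t 1 (fun s => f s * g s) (df * g t + f t * dg).
Proof. by move=> hf hg; rewrite addrC [df * _]mulrC; exact: is_deriveM. Qed.

Lemma is_derive_mull (R : realType) (f : R -> R) (k t df : R) :
  is_derive t 1 f df -> is_derive t 1 (fun s => k * f s) (k * df).
Proof. by move=> hf; exact: is_deriveZ. Qed.

Lemma is_derive_scaled_expR (R : realType) (c k t : R) :
  is_derive t 1 (fun t => c * expR (k * t)) (c * (k * expR (k * t))).
Proof.
apply: is_derive_mull; rewrite [k * expR _]mulrC.
have d1 : is_derive t 1 (fun t => k * t) k.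
  by rewrite -[X in is_derive _ _ _ X]mulr1; apply: is_derive_mull; exact: is_derive_id.
exact: (@is_derive1_comp R expR _ t _ _ (is_derive_expR _) d1).
Qed.

Lemma is_derive_within (R : realType) (f df : R -> R) (a b : R) :
  (forall t, a <= t <= b -> is_derive t 1 f (df t)) -> {within `[a, b], continuous f}.
Proof.
move=> fd; apply: continuous_in_subspaceT => t; rewrite inE/= in_itv/= => /fd.
exact: is_derive_continuous.
Qed.

Lemma coord_lipschitz_continuous (R : realType) (n : nat) (L : R)
    (F : ('I_n -> R) -> 'I_n -> R) (y : R -> 'I_n -> R) (t : R) (i : 'I_n) :
  0 < L -> coord_lipschitz L F -> (forall j, {for t, continuous (y^~ j)}) ->
  {for t, continuous (fun s => F (y s) i)}.
Proof.
move=> L0 FL cy; apply/cvgrPdist_le => e e0.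
suff H j : \forall s \near t, `|y t j - y s j| <= e / L.
  have := filter_forall (nbhs_filter t) H.
  apply: filterS => s /FL /(_ i) /le_trans; apply.
  by rewrite mulrC divfK ?gt_eqF.
have /cvgr_dist_le := cy j; apply; exact: divr_gt0.
Qed.

Lemma max0_continuous (R : realType) (f : R -> R) :
  (forall t, 0 <= t -> {for t, continuous f}) ->
  continuous (fun s : R => f (Num.max 0 s)).
Proof.
move=> cf t; have c0 : 0 <= Num.max 0 t by rewrite le_max lexx.
apply: (@continuous_comp _ _ _ (fun s : R => Num.max 0 s) f).
  by apply: continuous_max; [exact: cst_continuous|exact: cvg_id].
exact: cf.
Qed.

(** Freezing the previous iterate at negative times keeps the integrand continuous
    on the whole line, as the primitive requires. *)
Fixpoint picard_iter (R : realType) (n : nat) (F : ('I_n -> R) -> 'I_n -> R)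
    (x0 : 'I_n -> R) (m : nat) : R -> 'I_n -> R :=
  if m is m'.+1 then fun t i =>
    x0 i + primitive (fun s => F (picard_iter F x0 m' (Num.max 0 s)) i) t
  else fun=> x0.

(** In the weighted norm sup e^(-2 L t) |y(t)| the Picard operator contracts by
    1 / 2, so the iterates converge on the whole half-line. Inequalities between
    integrals are obtained by comparing derivatives. *)
Lemma global_solution (R : realType) (n : nat) (L : R)
    (F : ('I_n -> R) -> 'I_n -> R) (x0 : 'I_n -> R) :
  0 < L -> coord_lipschitz L F ->
  exists y : R -> 'I_n -> R, y 0 = x0 /\
    forall (t : R) i, 0 <= t -> is_derive t 1 (y^~ i) (F (y t) i).
Proof.
move=> L0 FL.
have solve (y : R -> 'I_n -> R) (t : R) i : 0 <= t ->
    (forall j, continuous (fun s : R => y (Num.max 0 s) j)) ->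
    is_derive t 1 (fun t => x0 i + primitive (fun s => F (y (Num.max 0 s)) i) t) (F (y t) i).
  move=> t0 cy.
  have cg : continuous (fun s : R => F (y (Num.max 0 s)) i).
    move=> s; exact: (@coord_lipschitz_continuous R n L F (fun s => y (Num.max 0 s)) s i L0
      FL (fun j => cy j s)).
  have := is_derive_primitive cg t0; rewrite (max_idPr t0) => dp.
  rewrite -[F (y t) i]add0r; apply: is_deriveD; exact: is_derive_cst.
pose Y := picard_iter F x0.
have Yd m (t : R) i : 0 <= t -> is_derive t 1 (Y m.+1 ^~ i) (F (Y m t) i).
  elim: m t i => [|m IH] t i t0; apply: solve => // j.
    exact: cst_continuous.
  by apply: (max0_continuous (f := Y m.+1 ^~ j)) => s /(IH s j)/is_derive_continuous.
have Yc m (t : R) i : 0 <= t -> {for t, continuous (Y m ^~ i)}.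
  case: m => [|m] t0; first exact: cst_continuous.
  exact: is_derive_continuous (Yd m t i t0).
have Y0 m : Y m 0 = x0.
  by case: m => // m; apply/funext => i; rewrite /Y/= primitive0 addr0.
pose k := 2 * L.
have K0 : exists2 A : R, 0 <= A & forall i, `|F x0 i| <= A * k.
  exists ((\sum_i `|F x0 i|) / k) => [|i].
    by rewrite divr_ge0 ?sumr_ge0// /k; lra.
  rewrite divfK ?gt_eqF ?mulr_gt0// (bigD1 i)//= lerDl.
  exact: sumr_ge0.
have [A A0 AF] := K0.
have Ystep m t i : 0 <= t -> `|Y m.+1 t i - Y m t i| <= A * 2 ^- m * expR (k * t).
  elim: m t i => [|m IH] t i t0.
    rewrite expr0 invr1 mulr1.
    have := @derive_norm_le_increment R (fun t => Y 1%N t i)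
      (fun t => A * expR (k * t)) (fun=> F x0 i) (fun t => A * (k * expR (k * t))) t t0.
    rewrite !Y0 mulr0 expR0 mulr1 => H.
    apply: le_trans (H _ _ _) _; last by lra.
    + by apply: is_derive_within => s /andP[s0 _]; exact: Yd.
    + by apply: is_derive_within => s _; exact: is_derive_scaled_expR.
    + move=> s /andP[s0 _]; split; [exact: Yd (ltW s0)|exact: is_derive_scaled_expR|].
      apply: le_trans (AF i) _; rewrite mulrA ler_peMr//.
        by rewrite mulr_ge0// /k; lra.
      by rewrite -expR0 ler_expR mulr_ge0 ?(ltW s0)// /k; lra.
  have := @derive_norm_le_increment R (fun t => Y m.+2 t i - Y m.+1 t i)
     (fun t => A * 2 ^- m.+1 * expR (k * t)) (fun t => F (Y m.+1 t) i - F (Y m t) i)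
     (fun t => A * 2 ^- m.+1 * (k * expR (k * t))) t t0.
  rewrite !Y0 mulr0 expR0 mulr1 subrr subr0 => H.
  apply: le_trans (H _ _ _) _.
  + apply: (is_derive_within (df := fun s => F (Y m.+1 s) i - F (Y m s) i)) => s /andP[s0 _].
    by apply: is_deriveB; exact: Yd.
  + by apply: is_derive_within => s _; exact: is_derive_scaled_expR.
  + move=> s /andP[/ltW s0 _]; split; [|exact: is_derive_scaled_expR|].
      by apply: is_deriveB; exact: Yd.
    apply: le_trans (FL _ _ _ (fun j => IH s j s0) i) _.
    by rewrite le_eqVlt; apply/orP; left; apply/eqP; rewrite exprS /k; field; rewrite expf_neq0.
  + by rewrite gerBl mulr_ge0// invr_ge0 exprn_ge0.
clearbody Y.
have /choice[y yP] (ti : R * 'I_n) : exists l, 0 <= ti.1 ->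
    forall m, `|l - Y m ti.1 ti.2| <= 2 * (A * expR (k * ti.1)) * 2 ^- m.
  have [t0|t0] := leP 0 ti.1; last by exists 0.
  have [m|l lY] := @geometric_limit R (fun m => Y m ti.1 ti.2) (A * expR (k * ti.1)).
    by rewrite mulrAC; exact: Ystep.
  by exists l.
have small (B e : R) : 0 <= B -> 0 < e -> exists m : nat, B * 2 ^- m <= e.
  move=> B0 e0; exists (Num.bound (B / e)).
  rewrite ler_pdivrMr ?exprn_gt0// -ler_pdivrMl// mulrC ltW//.
  exact: upper_nthrootP.
pose z t i := y (t, i).
have zYm m (t : R) i : 0 <= t -> `|z t i - Y m t i| <= 2 * (A * expR (k * t)) * 2 ^- m.
  by move=> t0; exact: yP (t, i) t0 m.
have zc i : continuous (fun s : R => z (Num.max 0 s) i).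
  move=> t; apply/cvgrPdist_le => e e0.
  pose t' := Num.max 0 t; have t'0 : 0 <= t' by rewrite le_max lexx.
  pose B := 2 * (A * expR (k * (t' + 1))).
  have B0 : 0 <= B by rewrite !mulr_ge0// expR_ge0.
  have e3 : 0 < e / 3 by lra.
  have [m mB] := small B (e / 3) B0 e3.
  have zY (s : R) : 0 <= s <= t' + 1 -> `|z s i - Y m s i| <= e / 3.
    move=> /andP[s0 st]; apply: le_trans mB; apply: le_trans (zYm m s i s0) _.
    rewrite ler_wpM2r ?invr_ge0 ?exprn_ge0// /B ler_wpM2l// ler_wpM2l//.
    by rewrite ler_expR ler_wpM2l// /k; lra.
  have mYc : continuous (fun s : R => Y m (Num.max 0 s) i).
    by apply: (max0_continuous (f := Y m ^~ i)) => s; exact: Yc.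
  have /cvgrPdist_le/(_ _ e3) := mYc t.
  have : \forall s \near t, s < t' + 1.
    by apply: lt_nbhsl; apply: (@le_lt_trans _ _ t'); [rewrite le_max lexx orbT|lra].
  apply: filterS2 => s st Ys.
  have s01 : 0 <= Num.max 0 s <= t' + 1.
    by rewrite le_max lexx/= ge_max (ltW st) andbT; lra.
  have := zY _ s01; have t01 : 0 <= t' <= t' + 1 by lra.
  have := zY _ t01; move: Ys; rewrite -/t' !ler_distl; lra.
pose w (t : R) i := x0 i + primitive (fun s : R => F (z (Num.max 0 s)) i) t.
have wd (t : R) i : 0 <= t -> is_derive t 1 (w ^~ i) (F (z t) i).
  by move=> t0; exact: solve.
have w0 : w 0 = x0 by apply/funext => i; rewrite /w primitive0 addr0.
clearbody w.
(* w is the Picard image of the limit z; both are approximated by the iterates. *)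
have wY m (t : R) i : 0 <= t -> `|w t i - Y m.+1 t i| <= A * 2 ^- m * expR (k * t).
  move=> t0.
  have := @derive_norm_le_increment R (fun t => w t i - Y m.+1 t i)
     (fun t => A * 2 ^- m * expR (k * t)) (fun t => F (z t) i - F (Y m t) i)
     (fun t => A * 2 ^- m * (k * expR (k * t))) t t0.
  rewrite !Y0 w0 mulr0 expR0 mulr1 subrr subr0 => H.
  apply: le_trans (H _ _ _) _.
  + apply: (is_derive_within (df := fun s => F (z s) i - F (Y m s) i)) => s /andP[s0 _].
    by apply: is_deriveB; [exact: wd|exact: Yd].
  + by apply: is_derive_within => s _; exact: is_derive_scaled_expR.
  + move=> s /andP[/ltW s0 _]; split; [|exact: is_derive_scaled_expR|].
      by apply: is_deriveB; [exact: wd|exact: Yd].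
    apply: le_trans (FL _ _ _ (fun j => zYm m s j s0) i) _.
    by rewrite le_eqVlt; apply/orP; left; apply/eqP; rewrite /k; ring.
  + by rewrite gerBl mulr_ge0// invr_ge0 exprn_ge0.
have wz (t : R) i : 0 <= t -> w t i = z t i.
  move=> t0; apply/eqP; rewrite -subr_eq0 -normr_eq0; apply: contraT => wz.
  have {}wz : 0 < `|w t i - z t i| by rewrite lt_def wz normr_ge0.
  have B0 : 0 <= 2 * (A * expR (k * t)) by rewrite !mulr_ge0// expR_ge0.
  have [|m mB] := small _ (`|w t i - z t i| / 2) B0; first by lra.
  have := wY m t i t0; have := zYm m.+1 t i t0.
  have -> : 2 * (A * expR (k * t)) * 2 ^- m.+1 = (2 * (A * expR (k * t)) * 2 ^- m) / 2.
    by rewrite exprS; field; rewrite expf_neq0.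
  have -> : A * 2 ^- m * expR (k * t) = (2 * (A * expR (k * t)) * 2 ^- m) / 2.
    by field; rewrite expf_neq0.
  have := ler_normD (w t i - Y m.+1 t i) (Y m.+1 t i - z t i).
  rewrite addrA subrK (distrC (Y _ _ _)); lra.
exists w; split => // t i t0.
have -> : w t = z t by apply/funext => j; exact: wz.
exact: wd.
Qed.
(** * First hitting times and logarithmic growth *)

Lemma within_continuousM (R : realType) (A : set R) (f g : R -> R) :
  {within A, continuous f} -> {within A, continuous g} ->
  {within A, continuous (fun x => f x * g x)}.
Proof. by move=> cf cg x; exact: (cvgM (cf x) (cg x)). Qed.

Lemma within_segmentS (R : realType) (f : R -> R) (t T : R) :
  t <= T -> {within `[0, T], continuous f} -> {within `[0, t], continuous f}.
Proof.
move=> tT; apply: continuous_subspaceW => s /=.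
by rewrite !in_itv/= => /andP[-> /le_trans->].
Qed.

Lemma within_continuous_dist (R : realType) (f : R -> R) (a b t e : R) :
  {within `[a, b], continuous f} -> a <= t <= b -> 0 < e ->
  exists2 d, 0 < d & forall s, a <= s <= b -> `|s - t| < d -> `|f s - f t| < e.
Proof.
move=> /subspace_continuousP cf tab e0.
have /cvgrPdist_lt/(_ e e0) : f @ within `[a, b] (nbhs t) --> f t.
  by apply: cf; rewrite /= in_itv.
move=> /nbhs_ballP[d /= d0 dP]; exists d => // s sab st.
rewrite distrC; apply: dP; last by rewrite /= in_itv.
by rewrite /ball/= distrC.
Qed.

(** The time t is the infimum of the set where f is nonnegative. *)
Lemma first_hit (R : realType) (f : R -> R) (T : R) :
  0 <= T -> {within `[0, T], continuous f} -> f 0 < 0 -> 0 <= f T ->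
  exists t, [/\ 0 < t <= T, f t = 0 & forall s, 0 <= s < t -> f s < 0].
Proof.
move=> T0 cf f0 fT.
pose Z := [set t | 0 <= t <= T /\ 0 <= f t].
have ZT : Z T by split; rewrite ?T0 ?lexx.
have Zlb : lbound Z 0 by move=> s [/andP[]].
have hiZ : has_inf Z by split; [exists T|exists 0].
pose t := inf Z.
have t0 : 0 <= t by apply: lb_le_inf => //; exists T.
have tT : t <= T by apply: ge_inf => //; exists 0.
have tI : 0 <= t <= T by rewrite t0.
have below s : 0 <= s < t -> f s < 0.
  move=> /andP[s0 st]; rewrite ltNge; apply/negP => fs.
  suff : t <= s by rewrite leNgt st.
  by apply: ge_inf; [exists 0|split => //; rewrite s0 (le_trans (ltW st))].
have ft_ge0 : 0 <= f t.
  rewrite leNgt; apply/negP => ft.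
  have nft : 0 < - f t by rewrite oppr_gt0.
  have [d d0 dP] := within_continuous_dist cf tI nft.
  suff : t + d <= t by lra.
  apply: lb_le_inf; first by exists T.
  move=> s [sT fs]; rewrite leNgt; apply/negP => std.
  have ts : t <= s by apply: ge_inf; [exists 0|split].
  have := dP s sT; rewrite ger0_norm ?subr_ge0// ltr_distl => /(_ _)/andP[|_]; lra.
have tpos : 0 < t by rewrite lt_def t0 andbT; apply: contraTneq ft_ge0 => ->; rewrite -ltNge.
exists t; split => //; first by rewrite tpos.
apply/eqP; rewrite eq_le ft_ge0 andbT leNgt; apply/negP => ft.
have [d d0 dP] := within_continuous_dist cf tI ft.
pose s := t - Num.min d t / 2.
have m0 : 0 < Num.min d t by rewrite lt_min d0.
have md : Num.min d t <= d by rewrite ge_min lexx.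
have mt : Num.min d t <= t by rewrite ge_min lexx orbT.
have sT : 0 <= s <= T by rewrite /s; apply/andP; split; lra.
have st : 0 <= s < t by rewrite /s; apply/andP; split; lra.
have := dP s sT; rewrite ltr0_norm ?subr_lt0; last by case/andP: st.
have := below s st; move: md mt m0; rewrite {2}/s => md mt m0 fs /(_ _).
by rewrite ltr_distl => /(_ _)/andP[|]; lra.
Qed.

(** A bootstrap: a strict inequality that improves its own weak form never
    fails. *)
Lemma continuity_principle (R : realType) (m : R -> R) (T : R) :
  {within `[0, T], continuous m} -> m 0 < 0 ->
  (forall t, 0 < t <= T -> (forall s, 0 <= s <= t -> m s <= 0) -> m t < 0) ->
  forall t, 0 <= t <= T -> m t < 0.
Proof.
move=> cm m0 mP t /andP[t0 tT]; rewrite ltNge; apply/negP => mt.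
have ct : {within `[0, t], continuous m}.
  exact: within_segmentS cm.
have [s [/andP[s0 st] ms below]] := first_hit t0 ct m0 mt.
have : m s < 0.
  apply: mP => [|r /andP[r0]]; first by rewrite s0 (le_trans st).
  by rewrite le_eqVlt => /predU1P[->|rs]; [rewrite ms|rewrite ltW// below// r0].
by rewrite ms ltxx.
Qed.

(** The function f^2 e^(2 M t) is nondecreasing because its derivative is
    2 (q + M) f^2 e^(2 M t); so f has no zero and keeps its sign. *)
Lemma growth_gt0 (R : realType) (f q : R -> R) (M T : R) :
  {within `[0, T], continuous f} -> 0 < f 0 ->
  (forall t, 0 < t < T -> is_derive t 1 f (f t * q t) /\ `|q t| <= M) ->
  forall t, 0 <= t <= T -> 0 < f t.
Proof.
move=> cf f0 fq.
have nz t : 0 <= t <= T -> f t != 0.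
  move=> /andP[t0 tT].
  have ct : {within `[0, t], continuous f}.
    exact: within_segmentS cf.
  have := @derive_le_increment R (fun=> 0) (fun s => f s * f s * (1 * expR (2 * M * s)))
    (fun=> 0) (fun s => (f s * q s * f s + f s * (f s * q s)) * (1 * expR (2 * M * s)) +
      f s * f s * (1 * (2 * M * expR (2 * M * s)))) t t0.
  rewrite subrr !mulr0 expR0 !mulr1 => H.
  apply: contraTneq (f0) => ft; rewrite -leNgt.
  have : 0 <= f t * f t * (1 * expR (2 * M * t)) - f 0 * f 0.
    apply: H.
    - by apply: continuous_subspaceT => s; exact: cst_continuous.
    - apply: within_continuousM; first exact: within_continuousM.
      by apply: is_derive_within => r _; exact: is_derive_scaled_expR.
    - move=> s /andP[s0 st].
      have sT : 0 < s < T by rewrite s0 (lt_le_trans st).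
      have [fd /ler_normlP[q1 q2]] := fq s sT.
      split; [exact: is_derive_cst| |].
        apply: is_derive_mul; first exact: is_derive_mul.
        exact: is_derive_scaled_expR.
      rewrite (_ : _ + _ = 2 * (f s ^+ 2 * (q s + M) * expR (2 * M * s))); last by ring.
      by apply: mulr_ge0 => //; apply: mulr_ge0 (expR_ge0 _); apply: mulr_ge0; [exact: sqr_ge0|lra].
  rewrite ft !mul0r sub0r oppr_ge0 -expr2 => h.
  have : f 0 ^+ 2 = 0 by apply/eqP; rewrite eq_le h sqr_ge0.
  by move/eqP; rewrite sqrf_eq0 => /eqP->.
move=> t tT; have [//|ft] := ltP 0 (f t).
have t0 : 0 <= t by case/andP: tT.
have cN : {within `[0, t], continuous (fun s => - f s)}.
  move=> s; apply: continuousN; move: s; apply: within_segmentS cf.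
  by case/andP: tT.
have [||s [/andP[s0 st] fs _]] := first_hit t0 cN.
- by rewrite oppr_lt0.
- by rewrite oppr_ge0.
have : f s != 0 by apply: nz; rewrite (ltW s0) (le_trans st)//; case/andP: tT.
by rewrite -oppr_eq0 fs eqxx.
Qed.
Lemma within_ln (R : realType) (f : R -> R) (T : R) :
  {within `[0, T], continuous f} -> (forall t, 0 <= t <= T -> 0 < f t) ->
  {within `[0, T], continuous (fun t => ln (f t))}.
Proof.
move=> /subspace_continuousP cf f0; apply/subspace_continuousP => t tT.
apply: (cvg_comp _ _ (cf t tT)); apply: continuous_ln; apply: f0.
by move: tT; rewrite /= in_itv.
Qed.

Lemma is_derive_ln_comp (R : realType) (f : R -> R) (t q : R) :
  0 < f t -> is_derive t 1 f (f t * q) -> is_derive t 1 (fun s => ln (f s)) q.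
Proof.
move=> f0 fd; have := is_derive1_comp (is_derive1_ln f0) fd.
by rewrite mulKf ?gt_eqF.
Qed.

Lemma is_derive_linear (R : realType) (c t : R) : is_derive t 1 (fun s => c * s) c.
Proof.
by rewrite -[X in is_derive _ _ _ X]mulr1; apply: is_derive_mull; exact: is_derive_id.
Qed.

Lemma within_linear (R : realType) (c T : R) :
  {within `[0, T], continuous (fun s => c * s)}.
Proof. by apply: is_derive_within => t _; exact: is_derive_linear. Qed.

Lemma increment_near_linear (R : realType) (f df : R -> R) (c B T : R) : 0 <= T ->
  {within `[0, T], continuous f} ->
  (forall t, 0 < t < T -> is_derive t 1 f (df t) /\ `|df t - c| <= B) ->
  `|f T - f 0 - c * T| <= B * T.
Proof.
move=> T0 cf fd.
have := @derive_norm_le_increment R (fun t => f t - c * t) (fun t => B * t)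
  (fun t => df t - c) (fun=> B) T T0.
rewrite !mulr0 !subr0 => H.
rewrite addrAC; apply: H.
- by move=> t; apply: continuousB; [exact: cf|exact: within_linear].
- exact: within_linear.
- move=> t /fd[? ?]; split=> //; last exact: is_derive_linear.
  by apply: is_deriveB; exact: is_derive_linear.
Qed.

Lemma increment_le_linear (R : realType) (f df : R -> R) (c T : R) : 0 <= T ->
  {within `[0, T], continuous f} ->
  (forall t, 0 < t < T -> is_derive t 1 f (df t) /\ df t <= c) ->
  f T - f 0 <= c * T.
Proof.
move=> T0 cf fd; have := @derive_le_increment _ f (fun t => c * t) df (fun=> c) T T0 cf.
rewrite mulr0 subr0; apply; first exact: within_linear.
by move=> t /fd[? ?]; split => //; exact: is_derive_linear.
Qed.

Lemma increment_ge_linear (R : realType) (f df : R -> R) (c T : R) : 0 <= T ->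
  {within `[0, T], continuous f} ->
  (forall t, 0 < t < T -> is_derive t 1 f (df t) /\ c <= df t) ->
  c * T <= f T - f 0.
Proof.
move=> T0 cf fd; have := @derive_le_increment _ (fun t => c * t) f (fun=> c) df T T0.
rewrite mulr0 subr0; apply => //; first exact: within_linear.
by move=> t /fd[? ?]; split => //; exact: is_derive_linear.
Qed.

(** * Orbits near the center manifold *)

(** The equations are required only while the point is in the box. This covers
    both the orbits of the system and the solutions of the clamped field. *)
Record solves (R : realType) (X : local_system R) (H d T : R) (v1 v2 r phi : R -> R)
    : Prop := Solves {
  solves_cont : [/\ {within `[0, T], continuous v1}, {within `[0, T], continuous v2},
    {within `[0, T], continuous r} & {within `[0, T], continuous phi}];
  solves_ode : forall t, 0 < t < T -> box H d (v1 t) (v2 t) (r t) ->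
    let x := vec [:: v1 t; v2 t; r t; phi t] in
    let u := v1 t * v2 t in
    [/\ is_derive t 1 v1 (v1 t * (p X (r t) + u * p0 X x)),
        is_derive t 1 v2 (v2 t * (sigma X (r t) + u * sigma0 X x)),
        is_derive t 1 r (u * r0 X x) &
        is_derive t 1 phi (omega X (r t) + u * omega0 X x)] }.

Lemma solvesS (R : realType) (X : local_system R) (H d t T : R) (v1 v2 r phi : R -> R) :
  t <= T -> solves X H d T v1 v2 r phi -> solves X H d t v1 v2 r phi.
Proof.
move=> tT [[c1 c2 c3 c4] ode]; split.
  by split; [exact: within_segmentS c1|exact: within_segmentS c2|
    exact: within_segmentS c3|exact: within_segmentS c4].
by move=> s /andP[s0 st]; apply: ode; rewrite s0 (lt_le_trans st).
Qed.

(** The equations for v1, v2 and u = v1 v2 are linear in the logarithm. The last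
    one gives u <= u(0) e^(- mu t), and integrating |r'| <= M u bounds the drift of
    r by M u(0) / mu, independently of T. *)
Lemma box_estimates (R : realType) (X : local_system R) (H d mu M T : R)
    (v1 v2 r phi : R -> R) :
  tame X H d mu M -> 0 <= T -> solves X H d T v1 v2 r phi ->
  0 < v1 0 -> 0 < v2 0 ->
  (forall t, 0 <= t <= T -> box H d (v1 t) (v2 t) (r t)) ->
  [/\ (forall t, 0 <= t <= T -> 0 < v1 t), (forall t, 0 <= t <= T -> 0 < v2 t),
      mu * T <= ln (v1 T) - ln (v1 0), ln (v2 T) - ln (v2 0) <= - mu * T &
      v1 T * v2 T <= v1 0 * v2 0 /\ `|r T - r 0| <= M * (v1 0 * v2 0) / mu].
Proof.
move=> tX T0 [[c1 c2 c3 c4] ode] v10 v20 inbox.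
have mu0 := tame_mu tX; have M0 := tame_M tX.
pose q1 t := p X (r t) + v1 t * v2 t * p0 X (vec [:: v1 t; v2 t; r t; phi t]).
pose q2 t := sigma X (r t) + v1 t * v2 t * sigma0 X (vec [:: v1 t; v2 t; r t; phi t]).
have {}ode t : 0 < t < T -> [/\ is_derive t 1 v1 (v1 t * q1 t),
    is_derive t 1 v2 (v2 t * q2 t) &
    is_derive t 1 r (v1 t * v2 t * r0 X (vec [:: v1 t; v2 t; r t; phi t]))].
  by move=> tT; have [|? ? ?] := ode t tT; first by apply: inbox; case/andP: tT => *; rewrite !ltW.
have sgn t : 0 <= t <= T -> [/\ mu <= q1 t, q2 t <= - mu & q1 t + q2 t <= - mu].
  by move=> /inbox b; exact: (tame_sign tX (phi t) b).
have coefM (c : 'rV[R]_4 -> R) t : coef_bound H d M c -> 0 <= t <= T ->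
    `|c (vec [:: v1 t; v2 t; r t; phi t])| <= M.
  by move=> cb /inbox b; have [] := cb _ _ _ (phi t) b.
have rateM (c : R -> R) t : rate_bound d M c -> 0 <= t <= T -> `|c (r t)| <= M.
  by move=> cb /inbox[_ _ b]; have [] := cb _ _ b b.
have uM t : 0 <= t <= T -> `|v1 t * v2 t| <= H * H.
  by move=> /inbox[? ? _]; rewrite normrM ler_pM.
have [pb sb ob] := tame_rate tX; have [p0b s0b r0b o0b] := tame_coef tX.
have qM (c : R -> R) (c0 : 'rV[R]_4 -> R) t : rate_bound d M c -> coef_bound H d M c0 ->
    0 <= t <= T ->
    `|c (r t) + v1 t * v2 t * c0 (vec [:: v1 t; v2 t; r t; phi t])| <= M + H * H * M.
  move=> cb c0b tT; apply: le_trans (ler_normD _ _) _; apply: lerD; first exact: rateM.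
  by rewrite normrM ler_pM// ?uM// coefM.
have oc t : 0 < t < T -> 0 <= t <= T by move=> /andP[? ?]; rewrite !ltW.
have P1 : forall t, 0 <= t <= T -> 0 < v1 t.
  apply: (growth_gt0 c1 v10 (q := q1) (M := M + H * H * M)) => t tT.
  by have [? _ _] := ode t tT; split => //; apply: qM => //; exact: oc.
have P2 : forall t, 0 <= t <= T -> 0 < v2 t.
  apply: (growth_gt0 c2 v20 (q := q2) (M := M + H * H * M)) => t tT.
  by have [_ ? _] := ode t tT; split => //; apply: qM => //; exact: oc.
have L1 t : 0 <= t <= T -> mu * t <= ln (v1 t) - ln (v1 0).
  move=> /andP[t0 tT].
  apply: (increment_ge_linear (f := fun s => ln (v1 s)) (df := q1) t0).
    by apply: within_segmentS tT _; exact: within_ln.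
  move=> s /andP[s0 st]; have sT : 0 < s < T by rewrite s0 (lt_le_trans st).
  have [? _ _] := ode s sT; have [? _ _] := sgn s (oc s sT); split => //.
  by apply: is_derive_ln_comp => //; apply: P1; exact: oc.
have L2 t : 0 <= t <= T -> ln (v2 t) - ln (v2 0) <= - mu * t.
  move=> /andP[t0 tT].
  apply: (increment_le_linear (f := fun s => ln (v2 s)) (df := q2) t0).
    by apply: within_segmentS tT _; exact: within_ln.
  move=> s /andP[s0 st]; have sT : 0 < s < T by rewrite s0 (lt_le_trans st).
  have [_ ? _] := ode s sT; have [_ ? _] := sgn s (oc s sT); split => //.
  by apply: is_derive_ln_comp => //; apply: P2; exact: oc.
have u0 t : 0 <= t <= T -> 0 < v1 t * v2 t by move=> tT; rewrite mulr_gt0 ?P1 ?P2.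
have cu : {within `[0, T], continuous (fun s => v1 s * v2 s)} by exact: within_continuousM.
have T00 : 0 <= (0 : R) <= T by rewrite lexx.
have LU t : 0 <= t <= T -> v1 t * v2 t <= v1 0 * v2 0 * expR (- mu * t).
  move=> tT; have /andP[t0 tT'] := tT.
  have : ln (v1 t * v2 t) - ln (v1 0 * v2 0) <= - mu * t.
    apply: (increment_le_linear (f := fun s => ln (v1 s * v2 s)) (df := fun s => q1 s + q2 s) t0).
      by apply: within_segmentS tT' _; exact: within_ln.
    move=> s /andP[s0 st]; have sT : 0 < s < T by rewrite s0 (lt_le_trans st).
    have [d1 d2 _] := ode s sT; have [_ _ ?] := sgn s (oc s sT); split => //.
    apply: is_derive_ln_comp; first by apply: u0; exact: oc.
    have := is_derive_mul d1 d2.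
    by rewrite (_ : _ + _ = v1 s * v2 s * (q1 s + q2 s)); last by ring.
  rewrite lerBlDl => h.
  have lnuK s : 0 <= s <= T -> v1 s * v2 s = expR (ln (v1 s * v2 s)).
    by move=> sT; rewrite lnK// posrE u0.
  by rewrite (lnuK t tT) (lnuK 0 T00) -expRD ler_expR.
split => //.
- by apply: L1; rewrite T0 lexx.
- by apply: L2; rewrite T0 lexx.
have TT : 0 <= T <= T by rewrite T0 lexx.
split.
  apply: le_trans (LU T TT) _; rewrite ler_piMr ?(ltW (u0 0 _))//.
  by rewrite -expR0 ler_expR mulNr oppr_le0 mulr_ge0// ltW.
pose B := M * (v1 0 * v2 0) / mu.
have B0 : 0 <= B by rewrite divr_ge0 ?mulr_ge0 ?ltW ?u0.
have := @derive_norm_le_increment R r (fun t => - B * expR (- mu * t))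
  (fun t => v1 t * v2 t * r0 X (vec [:: v1 t; v2 t; r t; phi t]))
  (fun t => - B * (- mu * expR (- mu * t))) T T0 c3.
rewrite mulr0 expR0 mulr1 => h; apply: le_trans (h _ _) _.
- by apply: is_derive_within => t _; exact: is_derive_scaled_expR.
- move=> t tT; have [_ _ dr] := ode t tT; split => //; first exact: is_derive_scaled_expR.
  have tT' := oc t tT.
  rewrite (_ : - B * _ = M * (v1 0 * v2 0 * expR (- mu * t))); last first.
    by rewrite /B; field; rewrite gt_eqF.
  rewrite normrM mulrC ler_pM//; first exact: coefM.
  by rewrite gtr0_norm ?u0 ?LU.
- by have := mulr_ge0 B0 (expR_ge0 (- mu * T)); rewrite -/B; lra.
Qed.
(** As long as the orbit is in the box, v2 decreases and r stays at distance less
    than d from b; with v1 < H the point is strictly inside the box, and the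
    bootstrap applies. *)
Lemma orbit_in_box (R : realType) (X : local_system R) (H d mu M T b : R)
    (v1 v2 r phi : R -> R) :
  tame X H d mu M -> solves X H d T v1 v2 r phi ->
  0 < v1 0 -> 0 < v2 0 < H -> 0 <= b <= 1 ->
  `|r 0 - b| + M * (v1 0 * v2 0) / mu < d ->
  (forall t, 0 <= t <= T -> v1 t < H) ->
  forall t, 0 <= t <= T -> box H d (v1 t) (v2 t) (r t).
Proof.
move=> tX sol v10 /andP[v20 v2H] b01 small v1H.
have mu0 := tame_mu tX; have M0 := tame_M tX.
pose m := (fun t => `|v1 t| - H) \max ((fun t => `|v2 t| - H) \max (fun t => `|r t - b| - d)).
have mE (t : R) : (m t < 0) = [&& `|v1 t| < H, `|v2 t| < H & `|r t - b| < d].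
  by rewrite /m/= !gt_max !subr_lt0.
have mbox (t : R) : m t <= 0 -> box H d (v1 t) (v2 t) (r t).
  by rewrite /m/= !ge_max !subr_le0 ler_distl => /and3P[? ? ?]; split => //; lra.
have cm : {within `[0, T], continuous m}.
  have [c1 c2 c3 _] := solves_cont sol.
  have cdist (f : R -> R) (a c : R) : {within `[0, T], continuous f} ->
      {within `[0, T], continuous (fun t => `|f t - a| - c)}.
    move=> cf t; apply: cvgB; last exact: cvg_cst.
    by apply: cvg_norm; apply: cvgB; [exact: cf|exact: cvg_cst].
  have cabs (f : R -> R) (c : R) : {within `[0, T], continuous f} ->
      {within `[0, T], continuous (fun t => `|f t| - c)}.
    by move=> cf t; apply: cvgB; [exact: cvg_norm (cf t)|exact: cvg_cst].
  move=> t; apply: continuous_max; last apply: continuous_max.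
  - exact: cabs.
  - exact: cabs.
  - exact: cdist.
have e0 : 0 < M * (v1 0 * v2 0) / mu by rewrite divr_gt0 ?mulr_gt0.
have key (t : R) : 0 <= t <= T -> (forall s, 0 <= s <= t -> m s <= 0) -> m t < 0.
  move=> /andP[t0 tT] ms.
  have [//|P1 P2 _ L2 [_ rt]] := box_estimates tX t0 (solvesS tT sol) v10 v20 _.
    by move=> s /ms/mbox.
  have tt : 0 <= t <= t by rewrite t0 lexx.
  have v1t := P1 t tt; have v2t := P2 t tt.
  rewrite mE (gtr0_norm v1t) (gtr0_norm v2t) v1H ?t0//=; apply/andP; split.
    apply: le_lt_trans v2H; rewrite -ler_ln ?posrE//.
    by have := mulr_ge0 (ltW mu0) t0; lra.
  have := ler_normD (r t - r 0) (r 0 - b); rewrite addrA subrK; lra.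
move=> t tT; apply: mbox; apply: ltW; move: t tT.
have [T0|T0] := leP 0 T; last by move=> t /andP[t0 tT]; have := le_trans t0 tT; rewrite leNgt T0.
apply: continuity_principle => //.
  rewrite mE (gtr0_norm v10) (gtr0_norm v20) v2H v1H ?lexx//=; lra.
by move=> t /andP[t0 tT]; apply: key; rewrite ltW.
Qed.

(** Along the orbit u <= U and |r - b| <= e, so each logarithmic rate differs from
    its value on the circle r = b by at most M (e + U). *)
Lemma orbit_asymptotics (R : realType) (X : local_system R) (H d mu M T b : R)
    (v1 v2 r phi : R -> R) :
  tame X H d mu M -> 0 <= T -> solves X H d T v1 v2 r phi ->
  0 < v1 0 -> 0 < v2 0 -> 0 <= b <= 1 ->
  (forall t, 0 <= t <= T -> box H d (v1 t) (v2 t) (r t)) ->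
  let U := v1 0 * v2 0 in
  let e := `|r 0 - b| + M * U / mu in
  [/\ `|ln (v1 T) - ln (v1 0) - p X b * T| <= M * (e + U) * T,
      `|ln (v2 T) - ln (v2 0) - sigma X b * T| <= M * (e + U) * T,
      `|phi T - phi 0 - omega X b * T| <= M * (e + U) * T &
      `|r T - b| <= e].
Proof.
move=> tX T0 sol v10 v20 b01 inbox U e.
have M0 := tame_M tX; have d0 : 0 < d by have /andP[] := tame_d tX.
have est t : 0 <= t <= T -> `|v1 t * v2 t| <= U /\ `|r t - b| <= e.
  move=> /andP[t0 tT].
  have [//|P1 P2 _ _ [ut rt]] := box_estimates tX t0 (solvesS tT sol) v10 v20 _.
    by move=> s /andP[s0 st]; apply: inbox; rewrite s0 (le_trans st).
  have tt : 0 <= t <= t by rewrite t0 lexx.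
  rewrite gtr0_norm ?mulr_gt0 ?P1 ?P2//; split => //.
  have := ler_normD (r t - r 0) (r 0 - b); rewrite addrA subrK /e /U; lra.
have [P1 P2 _ _ _] := box_estimates tX T0 sol v10 v20 inbox.
have oc t : 0 < t < T -> 0 <= t <= T by move=> /andP[? ?]; rewrite !ltW.
have bd : - d <= b <= 1 + d by lra.
have near (c : R -> R) (c0 : 'rV[R]_4 -> R) t : rate_bound d M c -> coef_bound H d M c0 ->
    0 < t < T ->
    `|c (r t) + v1 t * v2 t * c0 (vec [:: v1 t; v2 t; r t; phi t]) - c b| <= M * (e + U).
  move=> cb c0b /oc tT; have [ut rt] := est t tT.
  have B := inbox t tT; have [_ _ B3] := B.
  have [_ cL] := cb _ _ B3 bd; have [c0M _] := c0b _ _ _ (phi t) B.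
  rewrite addrAC mulrDr; apply: le_trans (ler_normD _ _) _; apply: lerD.
    by apply: le_trans cL _; rewrite ler_pM2l.
  by rewrite normrM mulrC ler_pM.
have [c1 c2 _ c4] := solves_cont sol.
have [pb sb ob] := tame_rate tX; have [p0b s0b _ o0b] := tame_coef tX.
split.
- apply: (increment_near_linear (f := fun t => ln (v1 t)) T0 (within_ln c1 P1)) => t tT.
  have [|dv1 _ _ _] := solves_ode sol tT; first by apply: inbox; exact: oc.
  split; first by apply: is_derive_ln_comp dv1; apply: P1; exact: oc.
  exact: near pb p0b tT.
- apply: (increment_near_linear (f := fun t => ln (v2 t)) T0 (within_ln c2 P2)) => t tT.
  have [|_ dv2 _ _] := solves_ode sol tT; first by apply: inbox; exact: oc.
  split; first by apply: is_derive_ln_comp dv2; apply: P2; exact: oc.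
  exact: near sb s0b tT.
- apply: (increment_near_linear T0 c4) => t tT.
  have [|_ _ _ dphi] := solves_ode sol tT; first by apply: inbox; exact: oc.
  by split; [exact: dphi|exact: near ob o0b tT].
- by have [] := est T; first by rewrite T0 lexx.
Qed.
(** * The local map *)

Definition clamp (R : realType) (a b x : R) : R := Num.max a (Num.min b x).

Lemma clamp_in (R : realType) (a b x : R) : a <= b -> a <= clamp a b x <= b.
Proof. by move=> ab; rewrite /clamp le_max lexx ge_max ab ge_min lexx. Qed.

Lemma clamp_id (R : realType) (a b x : R) : a <= x <= b -> clamp a b x = x.
Proof. by move=> /andP[ax xb]; rewrite /clamp (min_idPr xb) (max_idPr ax). Qed.

Lemma clamp_lipschitz (R : realType) (a b x y : R) :
  `|clamp a b x - clamp a b y| <= `|x - y|.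
Proof.
have max_lip (u v : R) : `|Num.max a u - Num.max a v| <= `|u - v|.
  have /ler_normlP[] := lexx `|u - v|; rewrite ler_norml.
  by have [?|?] := leP a u; have [?|?] := leP a v; lra.
have min_lip (u v : R) : `|Num.min b u - Num.min b v| <= `|u - v|.
  have /ler_normlP[] := lexx `|u - v|; rewrite ler_norml.
  by have [?|?] := leP b u; have [?|?] := leP b v; lra.
exact: le_trans (max_lip _ _) (min_lip _ _).
Qed.

Definition vector_field (R : realType) (X : local_system R) (v1 v2 r phi : R) : seq R :=
  let x := vec [:: v1; v2; r; phi] in let u := v1 * v2 in
  [:: v1 * (p X r + u * p0 X x); v2 * (sigma X r + u * sigma0 X x);
      u * r0 X x; omega X r + u * omega0 X x].

(** Products preserve Lipschitz estimates only together with bounds on the factors,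
    so the two are propagated jointly. *)
Definition close_bounded (R : realType) (K E a b : R) :=
  [/\ `|a| <= K, `|b| <= K & `|a - b| <= K * E].

Lemma close_boundedD (R : realType) (K K' E a b a' b' : R) :
  close_bounded K E a b -> close_bounded K' E a' b' ->
  close_bounded (K + K') E (a + a') (b + b').
Proof.
move=> [? ? ?] [? ? ?]; split; try by apply: le_trans (ler_normD _ _) _; apply: lerD.
by rewrite opprD addrACA mulrDl; apply: le_trans (ler_normD _ _) _; apply: lerD.
Qed.

Lemma close_boundedM (R : realType) (K K' E a b a' b' : R) : 
  close_bounded K E a b -> close_bounded K' E a' b' ->
  close_bounded (2 * (K * K')) E (a * a') (b * b').
Proof.
move=> [aK bK abK] [aK' bK' abK'].
have K0 : 0 <= K := le_trans (normr_ge0 _) aK.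
have K'0 : 0 <= K' := le_trans (normr_ge0 _) aK'.
have KK : 0 <= K * K' by rewrite mulr_ge0.
have two c : c <= K * K' -> c <= 2 * (K * K') by lra.
split; try by apply: two; rewrite normrM ler_pM.
have -> : a * a' - b * b' = (a - b) * a' + b * (a' - b') by ring.
apply: le_trans (ler_normD _ _) _; rewrite !normrM.
apply: le_trans (lerD (ler_pM _ _ abK aK') (ler_pM _ _ bK abK')) _ => //.
by rewrite le_eqVlt; apply/orP; left; apply/eqP; ring.
Qed.

Lemma close_boundedS (R : realType) (K K' E a b : R) : 0 <= E -> K <= K' ->
  close_bounded K E a b -> close_bounded K' E a b.
Proof.
move=> E0 KK [? ? h]; split; try by exact: le_trans KK.
by apply: le_trans h _; rewrite ler_wpM2r.
Qed.

(** Clamping v1, v2 and r to the box leaves the field unchanged there and makes it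
    Lipschitz on the whole space. *)
Lemma clamped_field_lipschitz (R : realType) (X : local_system R) (H d mu M : R) :
  tame X H d mu M ->
  exists2 L : R, 0 < L & coord_lipschitz L (fun (x : 'I_4 -> R) (i : 'I_4) =>
    (vector_field X (clamp (- H) H (x 0)) (clamp (- H) H (x 1))
       (clamp (- d) (1 + d) (x 2%R)) (x 3%R))`_i).
Proof.
move=> tX; have M0 := tame_M tX.
have /andP[H0 _] := tame_H tX; have /andP[d0 _] := tame_d tX.
pose K := H + M + 1.
pose L := 2 * (K * (K + 2 * (2 * (K * K) * K))) + (K + 2 * (2 * (K * K) * K)).
have K1 : 1 <= K by rewrite /K; lra.
have KK : 1 <= K * K by rewrite mulr_ege1.
have KKK : 1 <= 2 * (K * K) * K by rewrite mulr_ege1//; lra.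
have L0 : K + 2 * (2 * (K * K) * K) <= K * (K + 2 * (2 * (K * K) * K)).
  by rewrite ler_peMl//; lra.
exists L; first by rewrite /L; lra.
move=> x y E xyE.
have E0 : 0 <= E := le_trans (normr_ge0 _) (xyE 0).
have cl a b i : `|clamp a b (x i) - clamp a b (y i)| <= E.
  exact: le_trans (clamp_lipschitz _ _ _ _) (xyE i).
have boxP (z : 'I_4 -> R) : box H d (clamp (- H) H (z 0)) (clamp (- H) H (z 1))
    (clamp (- d) (1 + d) (z 2%R)).
  by split; rewrite ?ler_norml; apply: clamp_in; lra.
move: (boxP x) (boxP y) (cl (- H) H 0) (cl (- H) H 1) (cl (- d) (1 + d) 2%R) (xyE 3%R).
set v1 := clamp _ _ (x 0); set v2 := clamp _ _ (x 1); set r := clamp _ _ (x 2%R).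
set w1 := clamp _ _ (y 0); set w2 := clamp _ _ (y 1); set s := clamp _ _ (y 2%R).
move=> bx by_ h1 h2 h3 h4.
have EK : E <= K * E by rewrite ler_peMl.
have HK : H <= K by rewrite /K; lra.
have MK : M <= K by rewrite /K; lra.
have [bx1 bx2 bx3] := bx; have [by1 by2 by3] := by_.
have C1 : close_bounded K E v1 w1 by split; apply: le_trans; eauto.
have C2 : close_bounded K E v2 w2 by split; apply: le_trans; eauto.
have Cr (c : R -> R) : rate_bound d M c -> close_bounded K E (c r) (c s).
  move=> cb; have [xM xL] := cb _ _ bx3 by3; have [yM _] := cb _ _ by3 bx3.
  split; [exact: le_trans MK|exact: le_trans MK|].
  by apply: le_trans xL _; apply: ler_pM => //; lra.
have Cc (c : 'rV[R]_4 -> R) : coef_bound H d M c ->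
    close_bounded K E (c (vec [:: v1; v2; r; x 3%R])) (c (vec [:: w1; w2; s; y 3%R])).
  move=> cb; have [xM xL] := cb _ _ _ (x 3%R) bx; have [yM _] := cb _ _ _ (y 3%R) by_.
  split; [exact: le_trans MK|exact: le_trans MK|].
  by apply: le_trans (xL _ _ _ _ _ by_ h1 h2 h3 h4) _; rewrite ler_wpM2r.
have [pb sb ob] := tame_rate tX; have [p0b s0b r0b o0b] := tame_coef tX.
have Cu := close_boundedM C1 C2.
have Cuc c cb := close_boundedM Cu (Cc c cb).
have Cq c c0 cb c0b := close_boundedD (Cr c cb) (Cuc c0 c0b).
case=> -[|[|[|[|//]]]] ? /=.
- have C := close_boundedM C1 (Cq _ _ pb p0b).
  have [|//] := close_boundedS E0 _ C (K' := L); by rewrite /L; lra.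
- have C := close_boundedM C2 (Cq _ _ sb s0b).
  have [|//] := close_boundedS E0 _ C (K' := L); by rewrite /L; lra.
- have [|//] := close_boundedS E0 _ (Cuc _ r0b) (K' := L); by rewrite /L; lra.
- have [|//] := close_boundedS E0 _ (Cq _ _ ob o0b) (K' := L); by rewrite /L; lra.
Qed.
Lemma is_orbit_solves (R : realType) (X : local_system R) (H d T : R)
    (v1 v2 r phi : R -> R) :
  is_orbit X T v1 v2 r phi -> solves X H d T v1 v2 r phi.
Proof.
move=> [cont [_ ode]]; split => // t tT _.
have [d1 d2 d3 d4] := ode t tT; split => //.
  by apply: is_derive_eq d1 _; ring.
by apply: is_derive_eq d2 _; ring.
Qed.

Lemma solves_is_orbit (R : realType) (X : local_system R) (H d mu M T : R)
    (v1 v2 r phi : R -> R) :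
  tame X H d mu M -> solves X H d T v1 v2 r phi ->
  (forall t, 0 <= t <= T -> box H d (v1 t) (v2 t) (r t)) ->
  is_orbit X T v1 v2 r phi.
Proof.
move=> tX [cont ode] inbox; split => //; split.
  move=> t /inbox[b1 b2 b3].
  have /andP[_ HX] := tame_H tX; have /andP[_ dX] := tame_d tX.
  by split; [exact: le_lt_trans HX|exact: le_lt_trans HX|lra].
move=> t tT; have [|d1 d2 d3 d4] := ode t tT.
  by apply: inbox; case/andP: tT => *; rewrite !ltW.
split => //.
  by apply: is_derive_eq d1 _; ring.
by apply: is_derive_eq d2 _; ring.
Qed.

(** The solution of the clamped field stays in the box as long as v1 < H, so that
    v1 grows at rate mu at least and reaches h by time (ln h - ln v1) / mu. Up to
    the first hit the solution is an orbit of the system. *)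
Lemma loc_exists (R : realType) (X : local_system R) (H d mu M h b v1 r phi : R) :
  tame X H d mu M -> 0 < h < H -> 0 < v1 < h -> 0 <= b <= 1 ->
  `|r - b| + M * (v1 * h) / mu < d ->
  exists v2' r' phi', loc X h v1 r phi v2' r' phi'.
Proof.
move=> tX /andP[h0 hH] /andP[v10 v1h] b01 small.
have mu0 := tame_mu tX.
have [L L0 FL] := clamped_field_lipschitz tX.
have [y [y0 yd]] := global_solution (fun i : 'I_4 => [:: v1; h; r; phi]`_i) L0 FL.
pose x1 t := y t 0; pose x2 t := y t 1; pose x3 t := y t 2%R; pose x4 t := y t 3%R.
have sol T : solves X H d T x1 x2 x3 x4.
  split.
    by split; apply: is_derive_within => t /andP[t0 _]; exact: yd.
  move=> t /andP[/ltW t0 _] [b1 b2 b3].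
  move: b1 b2; rewrite !ler_norml => b1 b2.
  have := (yd t 0 t0, yd t 1 t0, yd t 2%R t0, yd t 3%R t0).
  by rewrite (clamp_id b1) (clamp_id b2) (clamp_id b3) => -[[[? ?] ?] ?].
have x10 : x1 0 = v1 by rewrite /x1 y0.
have x20 : x2 0 = h by rewrite /x2 y0.
have x30 : x3 0 = r by rewrite /x3 y0.
have inbox T : (forall t, 0 <= t <= T -> x1 t < H) ->
    forall t, 0 <= t <= T -> box H d (x1 t) (x2 t) (x3 t).
  by apply: (orbit_in_box tX (sol T) _ _ b01); rewrite ?x10 ?x20 ?h0 ?x30.
have cx1 (T : R) : {within `[0, T], continuous (fun t => x1 t - h)}.
  have [c1 _ _ _] := solves_cont (sol T).
  by move=> t; apply: cvgB; [exact: c1|exact: cvg_cst].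
have [s [s0 sh]] : exists s, 0 <= s /\ h <= x1 s.
  pose T := (ln h - ln v1) / mu.
  have T0 : 0 <= T by rewrite divr_ge0 ?(ltW mu0)// subr_ge0 ler_ln ?posrE// ltW.
  apply: contrapT => /forallNP noh.
  have x1h t : 0 <= t -> x1 t < h.
    by move=> t0; rewrite ltNge; apply/negP => hx; apply: (noh t).
  have TT : 0 <= T <= T by rewrite T0 lexx.
  have [|||P1 _ L1 _ _] := box_estimates tX T0 (sol T).
  - by rewrite x10.
  - by rewrite x20.
  - by apply: inbox => t /andP[t0 _]; rewrite (lt_trans (x1h t t0)).
  suff : ln (x1 T) < ln h.
    by move: L1; rewrite x10 mulrC divfK ?gt_eqF//; lra.
  by rewrite ltr_ln ?posrE ?P1// x1h.
have [||T [/andP[T0 Ts] hT below]] := first_hit s0 (cx1 s).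
- by rewrite x10 subr_lt0.
- by rewrite subr_ge0.
have x1T : x1 T = h by apply/eqP; rewrite -subr_eq0 hT.
exists (x2 T), (x3 T), (x4 T), T, x1, x2, x3, x4; split => //.
- exact: ltW.
- apply: solves_is_orbit tX (sol T) (inbox T _) => t /andP[t0].
  rewrite le_eqVlt => /predU1P[->|tT]; first by rewrite x1T.
  by apply: lt_trans hH; rewrite -subr_lt0 below// t0.
- by split => //; rewrite /x4 y0.
- by move=> t /below; rewrite subr_lt0.
Qed.

Lemma loc_estimates (R : realType) (X : local_system R)
    (H d mu M h b v1 r phi v2' r' phi' : R) :
  tame X H d mu M -> 0 < h < H -> 0 < v1 < h -> 0 <= b <= 1 ->
  `|r - b| + M * (v1 * h) / mu < d ->
  loc X h v1 r phi v2' r' phi' ->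
  let e := `|r - b| + M * (v1 * h) / mu in
  let eps := M * (e + v1 * h) in
  exists T, [/\ 0 <= T, mu * T <= ln h - ln v1,
    `|ln h - ln v1 - p X b * T| <= eps * T,
    0 < v2' & `|ln v2' - ln h - sigma X b * T| <= eps * T] /\
    `|phi' - phi - omega X b * T| <= eps * T /\ `|r' - b| <= e.
Proof.
move=> tX /andP[h0 hH] /andP[v10 v1h] b01 small.
move=> [T [x1 [x2 [x3 [x4 [T0 orb [x10 x20 x30 x40] [x1T x2T x3T x4T] below]]]]]].
have sol := is_orbit_solves H d orb.
have x1H t : 0 <= t <= T -> x1 t < H.
  move=> /andP[t0]; rewrite le_eqVlt => /predU1P[->|tT]; first by rewrite x1T.
  by apply: lt_trans hH; rewrite below// t0.
have P10 : 0 < x1 0 by rewrite x10.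
have P20 : 0 < x2 0 by rewrite x20.
have inbox : forall t, 0 <= t <= T -> box H d (x1 t) (x2 t) (x3 t).
  by apply: (orbit_in_box tX sol P10 _ b01); rewrite ?x10 ?x20 ?h0 ?x30.
have TT : 0 <= T <= T by rewrite T0 lexx.
have [_ P2 L1 _ _] := box_estimates tX T0 sol P10 P20 inbox.
have := orbit_asymptotics tX T0 sol P10 P20 b01 inbox.
rewrite x1T x2T x3T x4T x10 x20 x30 x40 => -[A1 A2 A3 A4].
exists T; split; last by split.
by split => //; [rewrite -x1T -x10|rewrite -x2T; exact: P2].
Qed.
(** * The global map *)

Lemma eqO_sqr_bound (R : realType) (f : R -> R) :
  (f : R -> R^o) =O_ (nbhs (0 : R)) (fun v : R => v ^+ 2 : R^o) ->
  exists k d : R, [/\ 0 < k, 0 < d & forall v, `|v| < d -> `|f v| <= k * v ^+ 2].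
Proof.
move=> /eqO_exP[k k0 /nbhs_ballP[d /= d0 dP]].
exists k, d; split => // v vd.
have := dP v; rewrite /ball/= sub0r normrN => /(_ vd) /le_trans; apply.
by rewrite ger0_norm ?sqr_ge0.
Qed.

Lemma slope_unique (R : realType) (f : R -> R) (a a' : R) :
  (fun v => f v - a * v : R^o) =O_ (nbhs (0 : R)) (fun v : R => v ^+ 2 : R^o) ->
  (fun v => f v - a' * v : R^o) =O_ (nbhs (0 : R)) (fun v : R => v ^+ 2 : R^o) ->
  a = a'.
Proof.
move=> /eqO_sqr_bound[k [d [k0 d0 kd]]] /eqO_sqr_bound[k' [d' [k'0 d'0 kd']]].
apply/eqP; rewrite -subr_eq0 -normr_eq0; apply: contraT => aa.
have {}aa : 0 < `|a - a'| by rewrite lt_def aa normr_ge0.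
have kk : 0 < k + k' by lra.
pose v := Num.min (d / 2) (Num.min (d' / 2) (`|a - a'| / (k + k') / 2)).
have v0 : 0 < v by rewrite /v !lt_min !divr_gt0.
have [vd vd' va] : [/\ v <= d / 2, v <= d' / 2 & v <= `|a - a'| / (k + k') / 2].
  by split; rewrite /v !ge_min lexx ?orbT.
have v2 : v * (k + k') <= `|a - a'| / 2 by move: va; rewrite mulrAC -ler_pdivlMr.
have /kd h : `|v| < d by rewrite gtr0_norm//; lra.
have /kd' h' : `|v| < d' by rewrite gtr0_norm//; lra.
have : `|a - a'| * v <= (k + k') * v * v.
  rewrite -{1}(gtr0_norm v0) -normrM.
  rewrite (_ : (a - a') * v = (f v - a' * v) - (f v - a * v)); last by ring.
  apply: le_trans (ler_normB _ _) _; apply: le_trans (lerD h' h) _.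
  by rewrite -mulrDl [k' + k]addrC expr2 mulrA.
by rewrite ler_pM2r// mulrC; lra.
Qed.

Lemma vec3_near (R : realType) (v w r s phi psi E : R) :
  `|v - w| <= E -> `|r - s| <= E -> `|phi - psi| <= E ->
  forall i, `|(vec [:: v; r; phi] : 'rV[R]_3) 0 i - (vec [:: w; s; psi] : 'rV[R]_3) 0 i| <= E.
Proof. by move=> h1 h2 h3 [[|[|[|//]]] ?]; rewrite !mxE. Qed.

Lemma row3E (R : realType) (x : 'rV[R]_3) : x = vec [:: x 0 0; x 0 1; x 0 2%R].
Proof.
by apply/rowP => -[[|[|[|//]]] ?]; rewrite mxE /=; congr (x _ _); exact: val_inj.
Qed.

Definition base_box (R : realType) (i : 'I_3) : set R :=
  nth `[0, 1]%classic [:: [set 0]] i.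

Lemma base_boxP (R : realType) (r phi : R) : 0 <= r <= 1 -> 0 <= phi <= 1 ->
  forall i, base_box i ((vec [:: 0; r; phi] : 'rV[R]_3) 0 i).
Proof. by move=> h1 h2 [[|[|[|//]]] ?]; rewrite mxE /base_box/= ?in_itv. Qed.

Lemma base_box_compact (R : realType) (i : 'I_3) : compact (@base_box R i).
Proof.
by case: i => -[|[|[|//]]] ?; [exact: compact_set1|exact: segment_compact|exact: segment_compact].
Qed.

Lemma base_boxE (R : realType) (x : 'rV[R]_3) : (forall i, base_box i (x 0 i)) ->
  [/\ x = vec [:: 0; x 0 1; x 0 2%R], 0 <= x 0 1 <= 1 & 0 <= x 0 2%R <= 1].
Proof.
move=> xb; have := xb 0; have := xb 1; have := xb 2%R.
by rewrite /base_box/= !in_itv/= => ? ? x0; split => //; rewrite {1}(row3E x) x0.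
Qed.

Lemma unit_shift (R : realType) (phi : R) : exists k : int, 0 <= phi + k%:~R <= 1.
Proof.
exists (- Num.floor phi).
have := floor_le phi; have := floorD1_gt phi; rewrite mulrNz intrD; lra.
Qed.

Lemma glob_lipschitz (R : realType) (f : 'rV[R]_3 -> R) (eps c : R) : 0 < eps ->
  (forall v r phi : R, `|v| < eps -> - eps < r < 1 + eps ->
     analytic_at f (vec [:: v; r; phi])) ->
  (forall v r phi : R, `|v| < eps -> - eps < r < 1 + eps ->
     f (vec [:: v; r; phi + 1]) = f (vec [:: v; r; phi]) + c) ->
  exists2 M : R, 0 < M & forall v r phi : R, `|v| < M^-1 -> 0 <= r <= 1 ->
    `|f (vec [:: v; r; phi]) - f (vec [:: 0; r; phi])| <= M * `|v|.
Proof.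
move=> eps0 fan fper.
have [x /base_boxE[xE ? ?]|M M0 fM] := compact_analytic_lipschitz (@base_box_compact R) (f := f).
  by rewrite xE; apply: fan; rewrite ?normr0//; lra.
have eV : 0 < eps^-1 by rewrite invr_gt0.
exists (M + eps^-1) => [|v r phi vM r01]; first by lra.
have ME : 0 < M + eps^-1 by lra.
have vM' : `|v| < M^-1 by apply: lt_le_trans vM _; rewrite lef_pV2 ?posrE//; lra.
have ve : `|v| < eps.
  by apply: lt_le_trans vM _; rewrite -[leRHS]invrK lef_pV2 ?posrE//; lra.
have [k kphi] := unit_shift phi.
have re : - eps < r < 1 + eps by lra.
have := @increment_int R (fun u => f (vec [:: v; r; u])) c (fun u => fper v r u ve re) k phi.
have e0 : `|0 : R| < eps by rewrite normr0.
have := @increment_int R (fun u => f (vec [:: 0; r; u])) c (fun u => fper 0 r u e0 re) k phi.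
move=> E0 Ev.
have := (fM _ (base_boxP r01 kphi)).2 (vec [:: v; r; phi + k%:~R]) `|v|.
rewrite normr_ge0 vM' E0 Ev => /(_ erefl) H.
rewrite distrC; apply: (@le_trans _ _ (M * `|v|)); last by rewrite ler_wpM2r//; lra.
rewrite opprD addrACA subrr addr0 in H; apply: H.
by apply: vec3_near; rewrite ?subrr ?normr0 ?sub0r ?normrN.
Qed.
(** The second order remainder at slope a1 is uniform near each point by
    analytic_at_scaling. It makes a1 continuous, being a uniform limit of
    difference quotients, so a1 is locally bounded away from 0 and infinity; only
    the value at a fixed small w is used for this. *)
Lemma slope_uniform (R : realType) (f : 'rV[R]_3 -> R) (eps : R) (a1 : R -> R -> R) :
  0 < eps ->
  (forall v r phi : R, `|v| < eps -> - eps < r < 1 + eps ->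
     analytic_at f (vec [:: v; r; phi])) ->
  (forall v r phi : R, `|v| < eps -> - eps < r < 1 + eps ->
     f (vec [:: v; r; phi + 1]) = f (vec [:: v; r; phi])) ->
  (forall r phi : R, 0 <= r <= 1 ->
     (fun v => f (vec [:: v; r; phi]) - a1 r phi * v : R^o)
       =O_ (nbhs (0 : R)) (fun v : R => v ^+ 2 : R^o)) ->
  (forall r phi : R, 0 <= r <= 1 -> 0 < a1 r phi) ->
  exists2 M : R, 0 < M & forall v r phi : R, 0 < v < M^-1 -> 0 <= r <= 1 ->
    `|f (vec [:: v; r; phi]) - a1 r phi * v| <= M * v ^+ 2 /\ M^-1 <= a1 r phi <= M.
Proof.
move=> eps0 fan fper fO a1_gt0.
have f_0 r phi : 0 <= r <= 1 -> f (vec [:: 0; r; phi]) = 0.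
  move=> /(fO r phi)/eqO_sqr_bound[k [d [k0 d0 /(_ 0)]]].
  by rewrite normr0 mulr0 subr0 expr0n/= mulr0 => /(_ d0); rewrite normr_le0 => /eqP.
(* The bound and a1 itself are 1-periodic in phi, so the period cell suffices. *)
suff [M M0 MP] : exists2 M : R, 0 < M & forall x : 'rV[R]_3, (forall i, base_box i (x 0 i)) ->
    (forall v : R, 0 < v < M^-1 ->
      `|f (vec [:: v; x 0 1; x 0 2%R]) - a1 (x 0 1) (x 0 2%R) * v| <= M * v ^+ 2) /\
    M^-1 <= a1 (x 0 1) (x 0 2%R) <= M.
  have eV : 0 < eps^-1 by rewrite invr_gt0.
  exists (M + eps^-1) => [|v r phi /andP[v0 vM] r01]; first by lra.
  have vM' : v < M^-1 by apply: lt_le_trans vM _; rewrite lef_pV2 ?posrE//; lra.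
  have ve : v < eps.
    by apply: lt_le_trans vM _; rewrite -[leRHS]invrK lef_pV2 ?posrE//; lra.
  have [k kphi] := unit_shift phi.
  have re : - eps < r < 1 + eps by lra.
  have fk u : `|u| < eps -> f (vec [:: u; r; phi + k%:~R]) = f (vec [:: u; r; phi]).
    move=> ue; have := @increment_int R (fun w => f (vec [:: u; r; w])) 0 _ k phi.
    by rewrite mul0r addr0; apply => w; rewrite addr0; exact: fper.
  have ak : a1 r (phi + k%:~R) = a1 r phi.
    apply: (@slope_unique R (fun v => f (vec [:: v; r; phi]))); last exact: fO.
    have [c [d [c0 d0 cd]]] := eqO_sqr_bound (fO r (phi + k%:~R) r01).
    apply/eqO_exP; exists c => //.
    have m0 : 0 < Num.min d eps by rewrite lt_min d0.
    apply/nbhs_ballP; exists (Num.min d eps) => //= u.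
    rewrite /ball/= sub0r normrN lt_min => /andP[ud ue].
    by rewrite -fk// (ger0_norm (sqr_ge0 u)); exact: cd.
  have ve' : `|v| < eps by rewrite gtr0_norm.
  have := MP _ (base_boxP r01 kphi); rewrite !mxE/= ak => -[/(_ v)].
  rewrite v0 vM' (fk v ve') => /(_ erefl) h /andP[ha1 ha2]; split.
    by apply: le_trans h _; rewrite ler_wpM2r ?sqr_ge0//; lra.
  apply/andP; split; last by lra.
  by apply: le_trans ha1; rewrite lef_pV2 ?posrE//; lra.
have := @compact_uniform R 3 [set x | forall i, base_box i (x 0 i)]
  (fun M (x : 'rV[R]_3) => (forall v : R, 0 < v < M^-1 ->
      `|f (vec [:: v; x 0 1; x 0 2%R]) - a1 (x 0 1) (x 0 2%R) * v| <= M * v ^+ 2) /\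
    M^-1 <= a1 (x 0 1) (x 0 2%R) <= M) (rV_compact (@base_box_compact R)).
apply => c /base_boxE[cE c1 c2].
have can : analytic_at f c by rewrite cE; apply: fan; rewrite ?normr0//; lra.
have [e1 [M1 [e10 M10 sM]]] := analytic_at_scaling can.
have [e2 [M2 [e20 M20 lM]]] := analytic_at_lipschitz can.
have c0 : c 0 0 = 0 by rewrite cE mxE.
pose e := Num.min e1 e2.
have e0 : 0 < e by rewrite lt_min e10.
have [ee1 ee2] : e <= e1 /\ e <= e2 by rewrite !ge_min !lexx orbT.
have nearc v r phi : `|v| <= e -> `|r - c 0 1| <= e -> `|phi - c 0 2%R| <= e ->
    forall i, `|(vec [:: v; r; phi] : 'rV[R]_3) 0 i - c 0 i| <= e.
  by move=> h1 h2 h3; rewrite cE; apply: vec3_near; rewrite ?subr0.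
have taylor v r phi : 0 <= r <= 1 -> 0 < v <= e -> `|r - c 0 1| <= e ->
    `|phi - c 0 2%R| <= e ->
    `|f (vec [:: v; r; phi]) - a1 r phi * v| <= (M1 + 1) * v ^+ 2.
  move=> r01 /andP[v0 ve] rc phic.
  have [k [d [k0 d0 kd]]] := eqO_sqr_bound (fO r phi r01).
  (* k t <= 1 makes the difference quotient at t v accurate to v^2, not only O(v^2). *)
  pose t := Num.min 1 (Num.min (d / (2 * v)) k^-1).
  have t0 : 0 < t by rewrite !lt_min ltr01 !(divr_gt0, invr_gt0) ?mulr_gt0.
  have t1 : t <= 1 by rewrite ge_min lexx.
  have tv : t * v < d.
    have : t <= d / (2 * v) by rewrite !ge_min lexx !orbT.
    rewrite ler_pdivlMr ?mulr_gt0//; lra.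
  have kt : k * t <= 1.
    by rewrite -ler_pdivlMl// mulr1 !ge_min lexx !orbT.
  have sc s : scale0 c (vec [:: v; r; phi]) s = vec [:: s * v; r; phi].
    by apply/rowP => -[[|[|[|//]]] ?]; rewrite !mxE//= c0 add0r subr0.
  have ve' : `|v| <= e by rewrite gtr0_norm.
  have := sM (vec [:: v; r; phi]) t.
  rewrite !sc mul0r f_0// !subr0 mxE/= c0 subr0 t0 t1 => /(_ _ erefl) h.
  have {}h := h (fun i => le_trans (nearc v r phi ve' rc phic i) ee1).
  have := kd (t * v); rewrite gtr0_norm ?mulr_gt0// => /(_ tv) h2.
  have h3 : `|t^-1 * f (vec [:: t * v; r; phi]) - a1 r phi * v| <= v ^+ 2.
    rewrite (_ : _ - _ = t^-1 * (f (vec [:: t * v; r; phi]) - a1 r phi * (t * v))); last first.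
      by field; rewrite gt_eqF.
    rewrite normrM gtr0_norm ?invr_gt0// ler_pdivrMl//.
    apply: le_trans h2 _; rewrite exprMn.
    rewrite (_ : k * _ = k * t * (t * v ^+ 2)); last by ring.
    by rewrite ler_piMl// mulr_ge0 ?sqr_ge0// ltW.
  rewrite (_ : _ - _ = (f (vec [:: v; r; phi]) - t^-1 * f (vec [:: t * v; r; phi])) +
    (t^-1 * f (vec [:: t * v; r; phi]) - a1 r phi * v)); last by ring.
  by apply: le_trans (ler_normD _ _) _; rewrite mulrDl mul1r lerD.
pose al := a1 (c 0 1) (c 0 2%R).
have al0 : 0 < al by exact: a1_gt0.
have N0 : 0 < M1 + 1 by lra.
pose w := Num.min e (al / (8 * (M1 + 1))).
have w0 : 0 < w by rewrite lt_min e0 divr_gt0// mulr_gt0.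
have we : w <= e by rewrite ge_min lexx.
have Nw : (M1 + 1) * w <= al / 8.
  have : w <= al / (8 * (M1 + 1)) by rewrite ge_min lexx orbT.
  rewrite ler_pdivlMr ?mulr_gt0//; lra.
pose e' := Num.min e (al * w / (4 * M2)).
have e'0 : 0 < e' by rewrite lt_min e0 divr_gt0 ?mulr_gt0.
have e'e : e' <= e by rewrite ge_min lexx.
have Me' : M2 * e' <= al * w / 4.
  have : e' <= al * w / (4 * M2) by rewrite ge_min lexx orbT.
  rewrite ler_pdivlMr ?mulr_gt0//; lra.
have we0 : 0 < w <= e by rewrite w0.
have slope r phi : 0 <= r <= 1 -> `|r - c 0 1| <= e' -> `|phi - c 0 2%R| <= e' ->
    `|a1 r phi - al| <= al / 2.
  move=> r01 rc phic.
  have rce := le_trans rc e'e; have phice := le_trans phic e'e.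
  have h1 := taylor w r phi r01 we0 rce phice.
  have h2 : `|f (vec [:: w; c 0 1; c 0 2%R]) - al * w| <= (M1 + 1) * w ^+ 2.
    by apply: taylor => //; rewrite subrr normr0 ltW.
  have we' : `|w| <= e by rewrite gtr0_norm.
  have h3 : `|f (vec [:: w; r; phi]) - f (vec [:: w; c 0 1; c 0 2%R])| <= M2 * e'.
    have x1 i : `|(vec [:: w; r; phi] : 'rV[R]_3) 0 i - c 0 i| <= e2.
      exact: le_trans (nearc w r phi we' rce phice i) ee2.
    have x2 i : `|(vec [:: w; c 0 1; c 0 2%R] : 'rV[R]_3) 0 i - c 0 i| <= e2.
      apply: le_trans (nearc w _ _ we' _ _ i) ee2; by rewrite subrr normr0 ltW.
    apply: (lM _ _ x1 x2).2 (ltW e'0) _.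
    by apply: vec3_near => //; rewrite subrr normr0 ltW.
  rewrite -(ler_pM2r w0) -{1}(gtr0_norm w0) -normrM.
  rewrite (_ : (a1 r phi - al) * w = (f (vec [:: w; c 0 1; c 0 2%R]) - al * w) -
    (f (vec [:: w; r; phi]) - a1 r phi * w) +
    (f (vec [:: w; r; phi]) - f (vec [:: w; c 0 1; c 0 2%R]))); last by ring.
  apply: le_trans (ler_normD _ _) _.
  apply: le_trans (lerD (ler_normB _ _) (lexx _)) _.
  have : (M1 + 1) * w ^+ 2 <= al / 8 * w by rewrite expr2 mulrA ler_pM2r.
  lra.
exists e', (M1 + 1 + e^-1 + 2 / al + 2 * al); split => // x m xb xc mM.
have eV : 0 < e^-1 by rewrite invr_gt0.
have aV : 0 < 2 / al by rewrite divr_gt0.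
have m0 : 0 < m by lra.
have [_ x1 x2] := base_boxE xb.
split.
  move=> v /andP[v0 vm].
  have ve : v <= e.
    apply: ltW; apply: lt_le_trans vm _.
    by rewrite -[leRHS]invrK lef_pV2 ?posrE//; lra.
  have v0e : 0 < v <= e by rewrite v0.
  have := taylor v _ _ x1 v0e (le_trans (xc 1) e'e) (le_trans (xc 2%R) e'e).
  by move/le_trans; apply; rewrite ler_wpM2r ?sqr_ge0//; lra.
have := slope _ _ x1 (xc 1) (xc 2%R); rewrite ler_distl => /andP[h1 h2].
apply/andP; split; last by lra.
apply: (@le_trans _ _ (al / 2)); last by lra.
by rewrite -[leRHS]invrK lef_pV2 ?posrE ?invr_gt0//; [rewrite invf_div|]; lra.
Qed.
(** * The return map *)

Lemma ln_near1 (R : realType) (y : R) : `|y - 1| <= 1 / 2 -> `|ln y| <= 2 * `|y - 1|.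
Proof.
move=> y1; have := y1; rewrite ler_distl => /andP[yl _].
have y0 : 0 < y by lra.
have up : ln y <= y - 1.
  by rewrite -[X in ln X](subrK 1) addrC; apply: le_ln1Dx; lra.
have lo : - ln y <= y^-1 - 1.
  rewrite -lnV ?posrE// -[X in ln X](subrK 1) addrC; apply: le_ln1Dx.
  by have : 0 < y^-1 by [rewrite invr_gt0]; lra.
have lo' : y^-1 - 1 <= 2 * `|y - 1|.
  rewrite (_ : _ - _ = (1 - y) / y); last by field; rewrite gt_eqF.
  rewrite ler_pdivrMr//; apply: (@le_trans _ _ `|y - 1|).
    by rewrite distrC ler_norm.
  by rewrite mulrAC ler_peMl//; lra.
have := ler_norm (y - 1); have := normr_ge0 (y - 1).
by rewrite ler_norml; lra.
Qed.

(** T is eliminated between the approximate relations - (la + z + eta) = p T and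
    y = s T; the ratio s / p multiplies the error of the first. *)
Lemma passage_time_elimination (R : realType) (M mu p s la z eta T y D : R) :
  0 < mu -> mu <= p -> `|s| <= M ->
  `|- (la + z + eta) - p * T| <= D -> `|y - s * T| <= D ->
  `|y - (la + z) * (- s / p)| <= M / mu * (`|eta| + D) + D.
Proof.
move=> mu0 mup sM TD yD.
have p0 : 0 < p := lt_le_trans mu0 mup.
rewrite (_ : y - _ = - (s / p) * (eta + (- (la + z + eta) - p * T)) + (y - s * T)); last first.
  by field; rewrite gt_eqF.
apply: le_trans (ler_normD _ _) _; apply: lerD => //.
rewrite normrM normrN; apply: ler_pM => //.
  rewrite normrM (gtr0_norm (_ : 0 < p^-1)) ?invr_gt0//.
  by apply: ler_pM; rewrite ?invr_ge0 ?(ltW p0)// lef_pV2.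
by apply: le_trans (ler_normD _ _) _; apply: lerD.
Qed.

Lemma expR_ln_div (R : realType) (v h : R) : 0 < v -> 0 < h ->
  v = h * expR (ln (v / h)).
Proof.
by move=> v0 h0; rewrite lnK ?posrE ?divr_gt0// mulrC divfK// gt_eqF.
Qed.

(** The bounds at v = 0 inside the expansions identify b0 and c0 with the values of
    glob_r and glob_phi on the channel. *)
Lemma glob_uniform (R : realType) (g : global_map R) (a1 b0 b1 c0 c1 : R -> R -> R) :
  glob_expansion g a1 b0 b1 c0 c1 ->
  (forall r phi : R, 0 <= r <= 1 -> 0 < a1 r phi) ->
  exists2 K : R, 1 <= K & forall v r phi : R, 0 < v < K^-1 -> 0 <= r <= 1 ->
    let x := vec [:: v; r; phi] in
    [/\ `|glob_v1 g x - a1 r phi * v| <= K * v ^+ 2, K^-1 <= a1 r phi <= K,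
        `|glob_r g x - b0 r phi| <= K * v & `|glob_phi g x - c0 r phi| <= K * v].
Proof.
move=> gO a1_gt0; have eps0 := glob_eps_gt0 g.
have value0 (f : R -> R) (c c' : R) :
    (fun v => f v - (c + c' * v) : R^o) =O_ (nbhs (0 : R)) (fun v : R => v ^+ 2 : R^o) ->
    f 0 = c.
  move=> /eqO_sqr_bound[k [e [k0 e0 /(_ 0)]]].
  rewrite normr0 !mulr0 expr0n/= mulr0 addr0 => /(_ e0).
  by rewrite normr_le0 subr_eq0 => /eqP.
have [|||||Ka Ka0 KaP] := @slope_uniform R (glob_v1 g) (glob_eps g) a1 => //.
- by move=> v r phi ve re; have [] := glob_analytic phi ve re.
- by move=> v r phi ve re; have [] := glob_periodic phi ve re.
- by move=> r phi r01; have [] := gO r phi r01.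
have [|||Kb Kb0 KbP] := @glob_lipschitz R (glob_r g) (glob_eps g) 0 => //.
- by move=> v r phi ve re; have [] := glob_analytic phi ve re.
- by move=> v r phi ve re; rewrite addr0; have [] := glob_periodic phi ve re.
have [|||Kc Kc0 KcP] := @glob_lipschitz R (glob_phi g) (glob_eps g) (glob_deg g)%:~R => //.
- by move=> v r phi ve re; have [] := glob_analytic phi ve re.
- by move=> v r phi ve re; have [] := glob_periodic phi ve re.
exists (Ka + Kb + Kc + 1) => [|v r phi /andP[v0 vK] r01 x]; first by lra.
have inv K : 0 < K -> K <= Ka + Kb + Kc + 1 -> v < K^-1.
  by move=> K0 KK; apply: lt_le_trans vK _; rewrite lef_pV2 ?posrE//; lra.
have nv : `|v| = v by rewrite gtr0_norm.
have va : 0 < v < Ka^-1 by rewrite v0 inv//; lra.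
have vb : `|v| < Kb^-1 by rewrite nv inv//; lra.
have vc : `|v| < Kc^-1 by rewrite nv inv//; lra.
have [h1 /andP[h2 h2']] := KaP v r phi va r01.
have := KbP v r phi vb r01; have := KcP v r phi vc r01.
have [_ /value0-> /value0->] := gO r phi r01; rewrite nv => h3 h4.
split.
- by apply: le_trans h1 _; rewrite ler_wpM2r ?sqr_ge0//; lra.
- apply/andP; split; last by lra.
  by apply: le_trans h2; rewrite lef_pV2 ?posrE//; lra.
- by apply: le_trans h4 _; rewrite ler_wpM2r ?(ltW v0)//; lra.
- by apply: le_trans h3 _; rewrite ler_wpM2r ?(ltW v0)//; lra.
Qed.

(** The relative error of w against a v is at most K^2 v <= 1 / 2, and the
    logarithm is 2-Lipschitz at that distance from 1. *)
Lemma near_slope_log (R : realType) (K a v w : R) :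
  1 <= K -> K^-1 <= a <= K -> 0 < v -> K * v * (2 * K) <= 1 ->
  `|w - a * v| <= K * v ^+ 2 ->
  [/\ 0 < w, w <= 2 * K * v & `|ln (w / (a * v))| <= 2 * K ^+ 2 * v].
Proof.
move=> K1 /andP[aK Ka] v0 vK wav.
have K0 : 0 < K by lra.
have a0 : 0 < a by apply: lt_le_trans aK; rewrite invr_gt0.
have Kv : K * v <= a / 2.
  have : K * v * 2 <= K^-1 by rewrite -[leRHS]mul1r ler_pdivlMr//; lra.
  by lra.
have wav' : `|w - a * v| <= a / 2 * v.
  by apply: le_trans wav _; rewrite expr2 mulrA ler_pM2r.
have av : 0 < a * v by rewrite mulr_gt0.
have aKv : a * v <= K * v by rewrite ler_pM2r.
have yE : `|w / (a * v) - 1| <= K ^+ 2 * v.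
  rewrite (_ : _ - 1 = (w - a * v) / (a * v)); last by field; rewrite !gt_eqF.
  rewrite normrM normfV (gtr0_norm av) ler_pdivrMr//.
  apply: le_trans wav _.
  rewrite (_ : K ^+ 2 * v * (a * v) = K * v ^+ 2 * (K * a)); last by ring.
  have Ka1 : 1 <= K * a by rewrite -ler_pdivrMl// mulr1.
  by apply: ler_peMr => //; rewrite mulr_ge0 ?sqr_ge0// ltW.
move: wav'; rewrite ler_distl => /andP[? ?]; split; [lra|lra|].
apply: le_trans (ln_near1 _) _; first by apply: le_trans yE _; lra.
by rewrite -mulrA ler_pM2l.
Qed.

Lemma small_enough (R : realType) (K K' d h : R) : 0 < K -> 0 < K' -> 0 < d -> 0 < h ->
  exists2 eps : R, 0 < eps & forall v, v < eps ->
    [/\ v < K^-1, K * v * (2 * K) <= 1, 2 * K * v < h, K' * v < d & v <= h * expR (-1)].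
Proof.
move=> K0 K'0 d0 h0.
exists (Num.min (K^-1) (Num.min ((2 * K * K)^-1) (Num.min (h / (2 * K))
   (Num.min (d / K') (h * expR (-1)))))).
  have q1 : 0 < K^-1 by rewrite invr_gt0.
  have q2 : 0 < (2 * K * K)^-1 by rewrite invr_gt0 !mulr_gt0.
  have q3 : 0 < h / (2 * K) by rewrite divr_gt0// mulr_gt0.
  have q4 : 0 < d / K' by rewrite divr_gt0.
  have q5 : 0 < h * expR (-1) by rewrite mulr_gt0// expR_gt0.
  by rewrite !lt_min q1 q2 q3 q4.
move=> v; rewrite !lt_min => /and5P[h1 h2 h3 h4 h5]; split => //; last exact: ltW.
- have : v * (2 * K * K) <= 1 by rewrite -ler_pdivlMr ?mulr_gt0// mul1r ltW.
  by lra.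
- by rewrite mulrC -ltr_pdivlMr ?mulr_gt0.
- by rewrite mulrC -ltr_pdivlMr.
Qed.

Lemma oppr_ln_le (R : realType) (K a : R) : 0 < K -> K^-1 <= a -> - ln a <= K.
Proof.
move=> K0 aK.
have : ln K^-1 <= ln a by rewrite ler_ln ?posrE ?(lt_le_trans _ aK)// invr_gt0.
rewrite lnV ?posrE//; have : ln (1 + (K - 1)) <= K - 1 by apply: le_ln1Dx; lra.
by rewrite addrC subrK; lra.
Qed.

Theorem theorem1 (R : realType) (X : local_system R) :
  exists2 h0 : R, 0 < h0 & forall h : R, 0 < h < h0 ->
  forall (g : global_map R) (a1 b0 b1 c0 c1 : R -> R -> R),
    glob_expansion g a1 b0 b1 c0 c1 ->
    (forall r phi : R, 0 <= r <= 1 -> 0 < a1 r phi) ->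
    (forall r phi : R, 0 <= r <= 1 -> 0 <= b0 r phi <= 1) ->
  exists (eps C : R), 0 < eps /\
  forall v2 r phi : R, 0 < v2 < eps -> 0 <= r <= 1 ->
    let z := ln (v2 / h) in
    let b := b0 r phi in
    (exists v2' r' phi' : R, return_map X h g v2 r phi v2' r' phi') /\
    forall v2' r' phi' : R, return_map X h g v2 r phi v2' r' phi' ->
      [/\ 0 < v2',
          `|ln (v2' / h) - (ln (a1 r phi) + z) * (- sigma X b / p X b)|
            <= C * (`|z| * expR z),
          `|r' - b| <= C * expR z &
          exists k : int,
            `|phi' - ((c0 r phi - omega X b / p X b * ln (a1 r phi))
                      + - omega X b / p X b * z) - k%:~R|
              <= C * (`|z| * expR z)].
Proof.
have [H [d [mu [M tX]]]] := tame_exists X.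
have mu0 := tame_mu tX; have M0 := tame_M tX.
have /andP[H0 HX] := tame_H tX; have /andP[d0 dX] := tame_d tX.
exists H => // h hH g a1 b0 b1 c0 c1 gO a1_gt0 b01.
have /andP[h0 _] := hH.
have [K K1 KP] := glob_uniform gO a1_gt0.
(* K' v2 bounds the distance of r to b, K4 |z| the passage time, and K5 v2 the error
   of the rates. *)
pose K' := K + 2 * K * M * h / mu.
pose K4 := (K + 2) / mu.
pose K5 := M * (K' + 2 * K * h).
have K0 : 0 < K by lra.
have Kmu : 0 < 2 * K * M * h / mu by rewrite divr_gt0// !mulr_gt0.
have K'0 : 0 < K' by rewrite /K'; lra.
have K40 : 0 < K4 by rewrite divr_gt0//; lra.
have K50 : 0 < K5 by rewrite mulr_gt0// addr_gt0// !mulr_gt0.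
pose C1 := M / mu * (2 * K ^+ 2 + K4 * K5) + K4 * K5.
have C10 : 0 < C1.
  have K45 : 0 < K4 * K5 by rewrite mulr_gt0.
  have KK : 0 < 2 * K ^+ 2 by rewrite mulr_gt0// exprn_gt0.
  by rewrite addr_gt0// mulr_gt0 ?divr_gt0// addr_gt0.
have [eps eps0 epsP] := small_enough K0 K'0 d0 h0.
exists eps, (h * (K' + K + C1)); split => // v2 r phi /andP[v20 /epsP[e1 e2 e3 e4 e5]] r01.
pose x := vec [:: v2; r; phi].
move=> z b.
have [|gv aK gr gphi] := KP v2 r phi _ r01; first by rewrite v20.
rewrite -/b -/x in gv gr gphi.
have a0 : 0 < a1 r phi by exact: a1_gt0.
have [w0 wK eta_le] := near_slope_log K1 aK v20 e2 gv.
have lna : - ln (a1 r phi) <= K by apply: oppr_ln_le => //; case/andP: aK.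
set a := a1 r phi in a0 eta_le lna *.
set w := glob_v1 g x in w0 wK eta_le *.
have v2E : v2 = h * expR z by exact: expR_ln_div.
have z1 : z <= -1.
  by rewrite /z -ler_expR lnK ?posrE ?divr_gt0// ler_pdivrMr// mulrC.
have zN : `|z| = - z by apply: ler0_norm; clear -z1; lra.
have zz : 1 <= `|z| by rewrite zN; clear -z1; lra.
clear gO a1_gt0 KP epsP gv aK.
have b01' : 0 <= b <= 1 by exact: b01.
have wh : 0 < w < h by rewrite w0 (le_lt_trans wK).
have eK : `|glob_r g x - b| + M * (w * h) / mu <= K' * v2.
  rewrite /K' mulrDl; apply: lerD => //.
  rewrite (_ : _ * v2 = M * (2 * K * v2 * h) / mu); last by ring.
  by rewrite ler_pM2r ?invr_gt0// ler_pM2l// ler_pM2r.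
have small : `|glob_r g x - b| + M * (w * h) / mu < d by exact: le_lt_trans e4.
split; first exact: loc_exists tX hH wh b01' small.
move=> v2' r' phi' /(loc_estimates tX hH wh b01' small).
move=> [T [[T0 muT A1 v2'0 A2] [A3 A4]]].
(* ln (w / h) = ln a + z + eta, with eta = O(v2). *)
pose eta := ln (w / (a * v2)).
rewrite -/eta in eta_le.
have lnw : ln w = ln a + z + eta + ln h.
  have vh : 0 < v2 / h by rewrite divr_gt0.
  have wav : 0 < w / (a * v2) by rewrite divr_gt0 ?mulr_gt0.
  have wE : w = a * (v2 / h) * (w / (a * v2)) * h by field; rewrite !gt_eqF.
  have az : 0 < a * (v2 / h) by rewrite mulr_gt0.
  have azw : 0 < a * (v2 / h) * (w / (a * v2)) by rewrite mulr_gt0.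
  by rewrite {1}wE lnM ?posrE// lnM ?posrE// lnM.
have SE : ln h - ln w = - (ln a + z + eta) by rewrite lnw; ring.
rewrite SE in muT A1.
have Tz : T <= K4 * `|z|.
  rewrite /K4 mulrAC ler_pdivlMr// mulrC; apply: le_trans muT _.
  have eta1 : - eta <= 1.
    by move: eta_le; rewrite ler_norml => /andP[e _]; clear -e e2; lra.
  have : K + 1 <= (K + 1) * `|z| by rewrite ler_peMr//; clear -K1; lra.
  by rewrite zN; clear -eta1 lna; lra.
have DE : M * (`|glob_r g x - b| + M * (w * h) / mu + w * h) * T <= K4 * K5 * (v2 * `|z|).
  have -> : K4 * K5 * (v2 * `|z|) = (K5 * v2) * (K4 * `|z|) by ring.
  have wh0 : 0 < w * h by rewrite mulr_gt0.
  have wh1 : w * h <= 2 * K * h * v2 by rewrite [leRHS]mulrAC ler_pM2r.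
  have e0 : 0 <= M * (w * h) / mu by rewrite divr_ge0 ?mulr_ge0// ltW.
  apply: ler_pM => //.
    by rewrite mulr_ge0 ?(ltW M0)// addr_ge0 ?addr_ge0// ltW.
  by rewrite /K5 -[leRHS]mulrA ler_pM2l// [leRHS]mulrDl lerD.
have vz : v2 <= v2 * `|z| by rewrite ler_peMr// ltW.
have pmu : mu <= p X b.
  have b00 : box H d 0 0 b.
    by split; rewrite ?normr0 ?ltW//; clear -b01' d0; lra.
  by have [] := tame_sign tX 0 b00; rewrite !mul0r addr0.
have bd : - d <= b <= 1 + d by clear -b01' d0; lra.
have [_ sb ob] := tame_rate tX.
have main (s y : R) : `|s| <= M ->
    `|y - s * T| <= M * (`|glob_r g x - b| + M * (w * h) / mu + w * h) * T ->
    `|y - (ln a + z) * (- s / p X b)| <= C1 * (v2 * `|z|).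
  move=> sM yD.
  apply: le_trans (passage_time_elimination mu0 pmu sM A1 yD) _.
  rewrite /C1 [leRHS]mulrDl lerD// -[leRHS]mulrA ler_pM2l ?divr_gt0// [leRHS]mulrDl lerD//.
  by apply: le_trans eta_le _; rewrite ler_pM2l// mulr_gt0// exprn_gt0.
have ez0 := expR_gt0 z.
have vzE : v2 * `|z| = h * (`|z| * expR z) by rewrite {1}v2E; ring.
have zE0 : 0 <= h * (`|z| * expR z) by rewrite -vzE mulr_ge0// ltW.
split => //.
- rewrite lnM ?posrE ?invr_gt0// lnV ?posrE//.
  apply: le_trans (main _ _ (sb b b bd bd).1 A2) _.
  by rewrite vzE mulrCA mulrA ler_wpM2r ?mulr_ge0 ?(ltW ez0)// ler_pM2l//; clear -K0 K'0 C10; lra.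
- apply: le_trans A4 _; apply: le_trans eK _; rewrite {1}v2E mulrA.
  by rewrite ler_pM2r// mulrC ler_pM2l//; clear -K0 K'0 C10; lra.
- exists 0; rewrite subr0.
  have A3' := main _ _ (ob b b bd bd).1 A3.
  rewrite (_ : _ - _ = (glob_phi g x - c0 r phi) +
     (phi' - glob_phi g x - (ln a + z) * (- omega X b / p X b))); last first.
    by rewrite -/a; ring.
  apply: le_trans (ler_normD _ _) _; apply: le_trans (lerD gphi A3') _.
  apply: (@le_trans _ _ ((K + C1) * (v2 * `|z|))).
    by rewrite [leRHS](mulrDl K C1) lerD// ler_pM2l.
  rewrite vzE mulrCA mulrA.
  by rewrite ler_wpM2r ?mulr_ge0 ?(ltW ez0)// ler_pM2l//; clear -K0 K'0 C10; lra.
Qed.
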